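(* Let $X$ be a triangulated truss with holes. Suppose that the boundary $\partial X$ consists of $g+1$ pairwise disjoint simple closed curves. Then $X$ is generic: the number $c$ of compatibility conditions equals the Maxwell number, $$c=\mathcal C_M=3g+v_i,$$ where $v_i$ is the number of interior vertices of $X$.
   Context: A triangulated truss consists of the vertices and edges of a finite piecewise linear triangulation, with nondegenerate triangles, of a (connected) planar domain: non-overlapping closed triangles meeting only in a common vertex or along a whole common edge, whose union is the closure of the domain. Here $X$ is such a triangulated domain bounded by pairwise disjoint simple closed curves $\gamma_0,\dots,\gamma_g$, where $\gamma_0$ contains the others within; each of $\gamma_1,\dots,\gamma_g$ has at least four links and does not surround any other $\gamma_j$. The holes are the regions bounded by $\gamma_1,\dots,\gamma_g$. Let $v$, $e$ be the numbers of vertices and edges. The prescribed elongations problem is the linear system $AU=\lambda$: given $\lambda\in\mathbf R^e$ find displacements $U_i\in\mathbf R^2$ at the vertices with $(V_i-V_j)\cdot(U_i-U_j)=\lambda_{ij}$ for every edge $V_iV_j$. The number of compatibility conditions $c$ is the codimension of the range of $A$ in $\mathbf R^e$. The Maxwell number is $\mathcal C_M=e-2v+3$. The truss is generic if $c=\mathcal C_M$ (equivalently, if it is infinitesimally rigid, i.e. $\ker A$ is three dimensional, consisting of velocity fields of rigid motions). *)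

(* Defs.v *)
From HB Require Import structures.
From mathcomp Require Import all_boot all_order all_algebra.
From mathcomp Require Import all_classical all_reals all_analysis.

Set Implicit Arguments.
Unset Strict Implicit.
Unset Printing Implicit Defensive.

Import Order.TTheory GRing.Theory Num.Theory.
Import numFieldNormedType.Exports.
Local Open Scope classical_set_scope.
Local Open Scope ring_scope.

(* The combinatorial and positional data only; a triangle is given by the set
   of its vertices. The geometric axioms are in [triangulated_domain]. *)
Record triangulation (R : realType) := Triangulation {
  nvert : nat;
  pos : 'I_nvert -> 'rV[R]_2;
  tri : {set {set 'I_nvert}} }.

Definition hull (R : realType) (X : triangulation R) (S : {set 'I_(nvert X)}) :
    set 'rV[R]_2 :=
  [set x | exists w : 'I_(nvert X) -> R,
    [/\ forall i, 0 <= w i,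
        forall i, i \notin S -> w i = 0,
        \sum_i w i = 1
      & x = \sum_i w i *: pos i]].

Definition carrier (R : realType) (X : triangulation R) : set 'rV[R]_2 :=
  [set x | exists2 t, t \in tri X & hull t x].

Definition adjacent (R : realType) (X : triangulation R) : rel 'I_(nvert X) :=
  fun i j => (i != j) && [exists t in tri X, (i \in t) && (j \in t)].

Definition triangle (R : realType) (X : triangulation R)
    (t : {set 'I_(nvert X)}) : Prop :=
  #|t| = 3%N /\
  forall i j k : 'I_(nvert X), t = [set i; j; k]%SET ->
    free [:: pos j - pos i; pos k - pos i].

(* Two distinct triangles share at most two vertices, so the fourth condition
   says that they are disjoint (hull of no vertex), or meet exactly in one
   common vertex, or exactly along one common edge. *)
Definition triangulated_domain (R : realType) (X : triangulation R) : Prop :=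
  [/\ injective (@pos R X),
      forall i, exists2 t, t \in tri X & i \in t,
      forall t, t \in tri X -> triangle t,
      forall s t, s \in tri X -> t \in tri X -> s != t ->
        hull s `&` hull t = hull (s :&: t)%SET
    & exists Omega : set 'rV[R]_2,
        [/\ Omega !=set0, open Omega, connected Omega
          & closure Omega = carrier X]].

(* A closed curve made of edges is given by the cyclic sequence of its
   vertices; its links join each vertex to the next one in the cycle, so the
   number of links is the size of the sequence. In a triangulated domain two
   edges meet at most in a common endpoint, so such a curve is simple as a
   point set. *)
Definition simple_closed_curve (R : realType) (X : triangulation R)
    (c : seq 'I_(nvert X)) : Prop :=
  [/\ (3 <= size c)%N, uniq c & cycle (@adjacent R X) c].

Definition curve_set (R : realType) (X : triangulation R) (c : seq 'I_(nvert X)) :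
    set 'rV[R]_2 :=
  [set x | exists2 i, i \in c & hull [set i; next c i]%SET x].

Definition inside (R : realType) (C : set 'rV[R]_2) : set 'rV[R]_2 :=
  [set x | ~ C x /\ bounded_set (connected_component (~` C) x)].

Definition surrounds (R : realType) (C D : set 'rV[R]_2) : Prop :=
  D `<=` inside C.

Definition frontier (R : realType) (A : set 'rV[R]_2) : set 'rV[R]_2 :=
  closure A `\` interior A.

Definition bounded_by (R : realType) (X : triangulation R) (g : nat)
    (gamma : 'I_g.+1 -> seq 'I_(nvert X)) : Prop :=
  [/\ forall i, simple_closed_curve (gamma i),
      forall i j, i != j -> curve_set (gamma i) `&` curve_set (gamma j) = set0,
      frontier (carrier X) = \bigcup_i curve_set (gamma i),
      forall j, j != ord0 -> surrounds (curve_set (gamma ord0)) (curve_set (gamma j))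
    & forall i, i != ord0 ->
        (4 <= size (gamma i))%N /\
        forall j, j != i -> ~ surrounds (curve_set (gamma i)) (curve_set (gamma j))].

(* Each unoriented edge is represented by its increasing pair of endpoints. *)
Definition edge (R : realType) (X : triangulation R) : finType :=
  {ij : 'I_(nvert X) * 'I_(nvert X) | (ij.1 < ij.2)%N && adjacent ij.1 ij.2}.

Definition dot (R : realType) (u v : 'rV[R]_2) : R := \sum_k u 0 k * v 0 k.

Definition elongation (R : realType) (X : triangulation R)
    (U : {ffun 'I_(nvert X) -> 'rV[R]_2}) : {ffun edge X -> R^o} :=
  [ffun a : edge X => dot (pos (val a).1 - pos (val a).2)
                          (U (val a).1 - U (val a).2)].

Lemma elongation_is_linear (R : realType) (X : triangulation R) :
  linear (@elongation R X).
Proof.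
move=> a u v; apply/ffunP => x; rewrite !ffunE /dot.
rewrite scaler_sumr -big_split; apply: eq_bigr => k _ /=.
rewrite !mxE /GRing.scale /=.
by rewrite mulrCA -mulrDr; congr (_ * _); rewrite mulrBr opprD addrACA.
Qed.

HB.instance Definition _ (R : realType) (X : triangulation R) :=
  GRing.isLinear.Build R {ffun 'I_(nvert X) -> 'rV[R]_2} {ffun edge X -> R^o}
    _ (@elongation R X) (@elongation_is_linear R X).

Definition compat_number (R : realType) (X : triangulation R) : nat :=
  (\dim {: {ffun edge X -> R^o}} - \dim (limg (linfun (@elongation R X))))%N.

Definition maxwell (R : realType) (X : triangulation R) : int :=
  #|{: edge X}|%:Z - 2 * (nvert X)%:Z + 3.

Definition generic (R : realType) (X : triangulation R) : Prop :=
  (compat_number X)%:Z = maxwell X.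

Definition interior_vertices (R : realType) (X : triangulation R) : nat :=
  #|[pred i : 'I_(nvert X) | pos i \in (interior (carrier X) : set _)]|.

(* Main.v *)
Require Import Defs.
From HB Require Import structures.
From mathcomp Require Import all_boot all_order all_algebra.
From mathcomp Require Import all_classical all_reals all_analysis.
From mathcomp Require Import zify ring lra.

(* By rigidity of a nondegenerate triangle, an infinitesimal motion which is rigid
   on one triangle is rigid on every triangle reached through common edges, hence
   on all of X, so that dim ker A = 3 and c = e - 2v + 3.

   The value of e - 2v + 3 follows from Euler's formula v + (t + g + 1) = e + 2
   together with 2e = 3t + b and v = v_i + b, where b counts the boundary vertices.
   Euler's formula is the statement, over the field with two elements, that the
   faces (the triangles and the g + 1 boundary curves, each capped by a disc)
   form a sphere: the graph of X and its dual graph are connected, and every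
   even set z of edges bounds a set of faces. For the last point, the parity of
   the number of edges of z above a point is constant on each open triangle and
   changes exactly across the edges of z. Adding to z the boundary of the set of
   triangles where it is odd leaves an even set of boundary edges, which is
   constant along each curve because a boundary vertex has just two boundary
   edges. *)

Set Implicit Arguments.
Unset Strict Implicit.
Unset Printing Implicit Defensive.

Import Order.TTheory GRing.Theory Num.Theory.
Import numFieldNormedType.Exports.
Local Open Scope classical_set_scope.
Local Open Scope ring_scope.

(** * Euler's formula over the field with two elements *)

(** The Jordan curve theorem is never invoked: the bounding of even edge sets rests on a count
    modulo two, where neither edges nor faces need an orientation. Half-lines through vertices are
    handled by half-open comparisons, and edges parallel to the half-lines by a generic shear.
    Rigidity passes from triangle to triangle only through whole edges, since two triangles sharing
    a single vertex may hinge there. The connected open set whose closure is X excludes such a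
    hinge: a segment close to the vertex bypasses it. *)

Lemma sum_bool_odd (I : finType) (P b : pred I) :
  \sum_(i | P i) b i = odd (\sum_(i | P i) nat_of_bool (b i))%N.
Proof. by rewrite (big_morph odd oddD (erefl _)); apply: eq_bigr => i _; rewrite oddb. Qed.

Lemma big_enum_val_all (T : finType) (A : zmodType) (F : T -> A) :
  \sum_(i < #|T|) F (enum_val i) = \sum_x F x.
Proof.
rewrite [RHS](reindex (@enum_val T T)); first by apply: eq_bigl => i.
exact/onW_bij/enum_val_bij.
Qed.

(** [bool] is taken as the field with two elements, with [addb] as addition and [andb] as
    multiplication. *)
Definition incidence_mx (V E : finType) (M : V -> E -> bool) : 'M[bool]_(#|V|, #|E|) :=
  \matrix_(i, j) M (enum_val i) (enum_val j).

(** Even columns put the all-ones vector in the left kernel and connectedness leaves only its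
    multiples, so the corank is one. *)
Lemma incidence_rank (V E : finType) (M : V -> E -> bool) :
  (0 < #|V|)%N -> (forall e, \sum_v M v e = 0) ->
  (forall u : V -> bool, (forall e, \sum_v u v * M v e = 0) -> forall v w, u v = u w) ->
  (\rank (incidence_mx M)).+1 = #|V|.
Proof.
move=> V0 even conn; set B := incidence_mx M.
have ker1 : \rank (kermx B) = 1%N.
  have -> : \rank (kermx B) = \rank (const_mx 1 : 'rV[bool]_#|V|).
    apply/eqmx_rank/andP; split.
      apply/row_subP => i; have : row i (kermx B) *m B = 0.
        by apply/sub_kermxP; rewrite row_sub.
      move: (row i _) => u uB.
      have cst := conn (fun v => u 0 (enum_rank v)).
      have {}cst : forall v w, u 0 v = u 0 w.
        move=> v w; rewrite -(enum_valK v) -(enum_valK w); apply: cst => e.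
        have /matrixP /(_ 0 (enum_rank e)) := uB; rewrite !mxE => uBe; rewrite -[RHS]uBe.
        rewrite -[LHS]big_enum_val_all; apply: eq_bigr => k _.
        by rewrite mxE enum_valK enum_rankK.
      have -> : u = u 0 (Ordinal V0) *: const_mx 1.
        by apply/rowP => k; rewrite !mxE mulr1.
      exact: scalemx_sub.
    apply/sub_kermxP/rowP => j; rewrite !mxE -[RHS](even (enum_val j)).
    rewrite -[RHS]big_enum_val_all.
    by apply: eq_bigr => k _; rewrite !mxE mul1r.
  rewrite rank_rV; case: eqP => // /rowP /(_ (Ordinal V0)).
  by rewrite !mxE => /eqP; rewrite oner_eq0.
by move: ker1 (rank_leq_row B); rewrite mxrank_ker; lia.
Qed.

(* [incv] and [incf] are the incidences of a cellular map on the sphere: the last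
   hypothesis, that every even set of edges is the boundary of a set of faces,
   is where sphericity enters. *)
Lemma euler_formula (V E F : finType) (incv : V -> E -> bool) (incf : F -> E -> bool) :
  (0 < #|V|)%N -> (0 < #|F|)%N ->
  (forall e, \sum_v incv v e = 0) -> (forall e, \sum_f incf f e = 0) ->
  (forall u : V -> bool, (forall e, \sum_v u v * incv v e = 0) -> forall v w, u v = u w) ->
  (forall u : F -> bool, (forall e, \sum_f u f * incf f e = 0) -> forall v w, u v = u w) ->
  (forall f v, \sum_e incf f e * incv v e = 0) ->
  (forall z : E -> bool, (forall v, \sum_e z e * incv v e = 0) ->
     exists u : F -> bool, forall e, z e = \sum_f u f * incf f e) ->
  (#|V| + #|F|)%N = #|E|.+2.
Proof.
move=> V0 F0 evV evF cV cF face_closed exact.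
have rV := incidence_rank V0 evV cV; have rF := incidence_rank F0 evF cF.
(* Even edge sets are exactly the sums of face boundaries. The former have dimension
   [#|E| - (#|V| - 1)], the latter [#|F| - 1]. *)
have : \rank (kermx (incidence_mx incv)^T) = \rank (incidence_mx incf).
  apply/eqmx_rank/andP; split.
    apply/row_subP => i; have : row i (kermx (incidence_mx incv)^T) *m (incidence_mx incv)^T = 0.
      by apply/sub_kermxP; rewrite row_sub.
    move: (row i _) => z zB; case: (exact (fun e => z 0 (enum_rank e))) => [v|u zu].
      have /matrixP /(_ 0 (enum_rank v)) := zB; rewrite !mxE => zBv; rewrite -[RHS]zBv.
      rewrite -[LHS]big_enum_val_all; apply: eq_bigr => k _.
      by rewrite !mxE enum_valK enum_rankK.
    apply/submxP; exists (\row_k u (enum_val k)); apply/rowP => j.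
    rewrite -(enum_valK j) zu !mxE -[LHS]big_enum_val_all; apply: eq_bigr => k _.
    by rewrite !mxE enum_rankK.
  apply/sub_kermxP/matrixP => i j; rewrite !mxE.
  rewrite -[RHS](face_closed (enum_val i) (enum_val j)) -[RHS]big_enum_val_all.
  by apply: eq_bigr => k _; rewrite !mxE.
rewrite mxrank_ker mxrank_tr; move: (rank_leq_col (incidence_mx incv)).
by lia.
Qed.

(** * Crossing parity in the plane *)

(** Twice the signed area of the triangle [a b x], positive when [x] is on the left of the line from
    [a] to [b]. *)
Definition orient (R : realFieldType) (a b x : R * R) : R :=
  (b.1 - a.1) * (x.2 - a.2) - (b.2 - a.2) * (x.1 - a.1).

(* The segment [pq] crosses the upward vertical half-line issued from [x]. The
   asymmetry in the comparisons counts a vertex on that half-line consistently. *)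
Definition above (R : realFieldType) (x p q : R * R) : bool :=
  ((p.1 <= x.1) (+) (q.1 <= x.1)) && ((q.1 - p.1) * orient p q x < 0).

(** The half-open range of abscissas is the one where the comparison with [p.1] in [above] differs
    between [x] and [y]. *)
Definition overlies (R : realFieldType) (x y p : R * R) : bool :=
  [&& x.1 < p.1, p.1 <= y.1 & 0 < orient x y p].

Lemma aboveC (R : realFieldType) (x p q : R * R) : above x p q = above x q p.
Proof.
by rewrite /above addbC; congr (_ && (_ < _)); rewrite /orient; ring.
Qed.

(** An intermediate value argument valid over any ordered field: with opposite signs at [u] and [v],
    the affine function would vanish at the explicit point of ratio [fu / (fu - fv)] between them,
    which convexity keeps in [C]. *)
Lemma affine_sign (R : realFieldType) (a b : R) (C : R -> Prop) (s t : R) :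
  (forall s t l, C s -> C t -> 0 <= l <= 1 -> C ((1 - l) * s + l * t)) ->
  (forall s, C s -> (1 - s) * a + s * b != 0) -> C s -> C t ->
  (0 < (1 - s) * a + s * b) = (0 < (1 - t) * a + t * b).
Proof.
move=> cvx nz; suff imp u v : C u -> C v ->
    0 < (1 - u) * a + u * b -> 0 < (1 - v) * a + v * b.
  by move=> Cs Ct; apply/idP/idP; apply: imp.
move=> Cu Cv pu; rewrite ltNge; apply/negP => nv.
have := pu; have := nv.
set fu := (1 - u) * _ + _ in pu *; set fv := (1 - v) * _ + _ in nv * => _ _.
have d0 : 0 < fu - fv by lra.
have := nz _ (cvx u v (fu / (fu - fv)) Cu Cv _).
case: (_ <= _ <= _) / andP => [_ /(_ isT)|[]]; last first.
  by rewrite divr_ge0 ?ler_pdivrMr //; lra.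
set l := fu / _; have ld : l * (fu - fv) = fu by rewrite mulfVK // gt_eqF.
have -> : (1 - ((1 - l) * u + l * v)) * a + ((1 - l) * u + l * v) * b =
  fu - l * (fu - fv) by rewrite /fu /fv; ring.
by rewrite ld subrr eqxx.
Qed.

(* Clipped to the strip over [xy], the segment [pq] stays on one side of the
   line [xy], so that only the ends lying in the strip can change the count. *)
Lemma above_uncrossed (R : realFieldType) (x y p q : R * R) : x.1 <= y.1 ->
  (forall s t, 0 <= s <= 1 -> 0 <= t <= 1 ->
     (1 - s) * p.1 + s * q.1 = (1 - t) * x.1 + t * y.1 ->
     (1 - s) * p.2 + s * q.2 = (1 - t) * x.2 + t * y.2 -> False) ->
  above x p q (+) above y p q = overlies x y p (+) overlies x y q.
Proof.
wlog pq : p q / p.1 <= q.1.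
  move=> W; have [pq|/ltW pq] := leP p.1 q.1; first exact: W.
  move=> xy nc; rewrite 2![above _ p q]aboveC [RHS]addbC; apply: W => // s t s01 t01 e1 e2.
  by apply: (nc (1 - s) t) => //; [lra|rewrite -e1; ring|rewrite -e2; ring].
(* When [x] and [y] have the same abscissa the strip is empty and nothing overlies it, so both
   counts must agree. *)
rewrite le_eqVlt => /orP[/eqP xy nc|xy nc].
  have ov r : overlies x y r = false.
    by rewrite /overlies -xy; case: ltP => //= h; rewrite leNgt h.
  rewrite !ov /= /above -xy.
  have [px|px] := leP p.1 x.1; have [qx|qx] := leP q.1 x.1 => //=.
    have d0 : 0 < q.1 - p.1 by lra.
    rewrite !pmulr_rlt0 //.
    suff -> : (orient p q x < 0) = (orient p q y < 0) by rewrite addbb.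
    (* The parameter at which [[pq]] meets the vertical line through [x] and [y]; that point is not
       between them, so it lies above both or below both. *)
    set s := (x.1 - p.1) / (q.1 - p.1).
    have sd : s * (q.1 - p.1) = x.1 - p.1 by rewrite mulfVK // gt_eqF.
    have s01 : 0 <= s <= 1.
      by rewrite divr_ge0 ?ler_pdivrMr //; lra.
    rewrite -[LHS]oppr_gt0 -[RHS]oppr_gt0.
    pose h (r : R * R) := (1 - s) * p.2 + s * q.2 - r.2.
    have hx (r : R * R) : r.1 = x.1 -> - orient p q r = (q.1 - p.1) * h r.
      by move=> rx; rewrite /orient /h rx -sd; ring.
    rewrite (hx x) // (hx y) // !pmulr_rgt0 //.
    have := @affine_sign _ (h x) (h y) (fun t => 0 <= t <= 1) 0 1.
    rewrite subr0 subrr !mul0r !mul1r addr0 add0r; apply; try lra.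
      by move=> u v l hu hv hl; nra.
    move=> t t01; apply/eqP => e; apply: (nc s t) => //; first by rewrite -xy; lra.
    by move: e; rewrite /h; lra.
  by lra.
have d0 : 0 < y.1 - x.1 by lra.
(* The parameters of the part of [[pq]] over the strip. There [orient x y] cannot vanish, as a zero
   would be a point of [[xy]]. *)
set C := fun s => 0 <= s <= 1 /\ x.1 <= (1 - s) * p.1 + s * q.1 <= y.1.
have sgn s t : C s -> C t -> (0 < (1 - s) * orient x y p + s * orient x y q) =
    (0 < (1 - t) * orient x y p + t * orient x y q).
  apply: affine_sign => {s t} [s t l [hs0 hs1] [ht0 ht1] hl|s [hs0 hs1]].
    by split; nra.
  apply/eqP => e; move: hs1; set P1 := (1 - s) * p.1 + _ => /andP[hP0 hP1].
  have ht : (P1 - x.1) / (y.1 - x.1) * (y.1 - x.1) = P1 - x.1 by rewrite mulfVK // gt_eqF.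
  apply: (nc s ((P1 - x.1) / (y.1 - x.1))) => //.
  - by rewrite divr_ge0 ?ler_pdivrMr ?subr_ge0 ?mul1r ?lerB // ltW.
  - rewrite -/P1; move: ht; set t := _ / _ => ht; clearbody P1 t; lra.
  - move: ht; set t := _ / _ => ht; apply: (mulfI (lt0r_neq0 d0)).
    have {}ht : P1 = x.1 + t * (y.1 - x.1) by rewrite ht; ring.
    have -> : (y.1 - x.1) * ((1 - s) * p.2 + s * q.2) = (1 - s) * orient x y p
      + s * orient x y q + (y.1 - x.1) * x.2 + (y.2 - x.2) * (P1 - x.1).
      by rewrite /orient /P1; ring.
    by rewrite e ht; ring.
have end0 : (1 - 0) * orient x y p + 0 * orient x y q = orient x y p by ring.
have end1 : (1 - 1) * orient x y p + 1 * orient x y q = orient x y q by ring.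
have C0 : x.1 <= p.1 <= y.1 -> C 0 by move=> ?; split; lra.
have C1 : x.1 <= q.1 <= y.1 -> C 1 by move=> ?; split; lra.
(* At the abscissa of an end [r] of [[xy]], that end is below [[pq]] exactly when the point of
   [[pq]] is above the line [xy]. *)
have clip (r : R * R) : r = x \/ r = y -> p.1 < q.1 -> p.1 <= r.1 <= q.1 -> exists2 s, C s &
   ((q.1 - p.1) * orient p q r < 0) = (0 < (1 - s) * orient x y p + s * orient x y q).
  move=> rxy lt_pq hr; have d1 : 0 < q.1 - p.1 by lra.
  have sd : (r.1 - p.1) / (q.1 - p.1) * (q.1 - p.1) = r.1 - p.1 by rewrite mulfVK // gt_eqF.
  exists ((r.1 - p.1) / (q.1 - p.1)).
    have s01 : 0 <= (r.1 - p.1) / (q.1 - p.1) <= 1.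
      by rewrite divr_ge0 ?ler_pdivrMr //; lra.
    split=> //; move: sd; set s := _ / _ => sd.
    suff -> : (1 - s) * p.1 + s * q.1 = r.1 by case: rxy => ->; lra.
    by lra.
  move: sd; set s := _ / _ => sd.
  rewrite pmulr_rlt0 // -[LHS]oppr_gt0 -(pmulr_rgt0 _ d0) -[RHS](pmulr_rgt0 _ d1).
  have rE : r.1 = s * (q.1 - p.1) + p.1 by lra.
  by congr (_ < _); case: rxy rE => -> rE; rewrite /orient rE; ring.
rewrite /above /overlies.
have [px|px] := leP p.1 x.1; have [qx|qx] := leP q.1 x.1 => /=.
- by have [py|py] := leP p.1 y.1; have [qy|qy] := leP q.1 y.1 => //=; lra.
- have -> : p.1 <= y.1 by lra.
  have [||s Cs ->] := clip x (or_introl erefl); try lra.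
  have [qy|qy] := leP q.1 y.1 => /=.
    by rewrite addbF (sgn s 1) ?end1 //; apply: C1; lra.
  have [||t Ct ->] := clip y (or_intror erefl); try lra.
  by rewrite (sgn s t) // addbb.
- by lra.
- have [py|py] := leP p.1 y.1; have [qy|qy] := leP q.1 y.1 => //=.
  + have := sgn 0 1; rewrite end0 end1 => ->; rewrite ?addbb //; [apply: C0; lra|apply: C1; lra].
  + have [||t Ct ->] := clip y (or_intror erefl); try lra.
    by rewrite addbF (sgn t 0) ?end0 //; apply: C0; lra.
  + by lra.
Qed.

(** * Barycentric coordinates *)

(* A generic [c] gives the vertices pairwise distinct abscissas, so that no edge
   is vertical. *)
Definition shear (R : realType) (c : R) (x : 'rV[R]_2) : R * R :=
  (x 0 0 + c * x 0 1, x 0 1).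

Lemma sum3 (T : finType) (V : zmodType) (i j k : T) (F : T -> V) :
  i != j -> i != k -> j != k -> (forall l, l \notin [set i; j; k]%SET -> F l = 0) ->
  \sum_l F l = F i + F j + F k.
Proof.
move=> ij ik jk F0; rewrite (bigD1 i) //= (bigD1 j) 1?eq_sym //=.
rewrite (bigD1 k) /=; last by rewrite ![k == _]eq_sym ik jk.
rewrite big1 ?addr0 ?addrA // => l /andP[/andP[li lj] lk].
by rewrite F0 // !inE !negb_or li lj.
Qed.

Lemma sum2 (T : finType) (V : zmodType) (i j : T) (F : T -> V) :
  i != j -> (forall l, l \notin [set i; j]%SET -> F l = 0) ->
  \sum_l F l = F i + F j.
Proof.
move=> ij F0; rewrite (bigD1 i) //= (bigD1 j) 1?eq_sym //=.
rewrite big1 ?addr0 // => l /andP[li lj].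
by rewrite F0 // !inE !negb_or li.
Qed.

Lemma cards3_eq (T : finType) (t : {set T}) : #|t| = 3%N ->
  exists i j k, [/\ t = [set i; j; k]%SET, i != j, i != k & j != k].
Proof.
move=> t3; have : (0 < #|t|)%N by rewrite t3.
case/card_gt0P => i it.
have /eqP /cards2P[j [k] [jk tD]] : #|(t :\ i)%SET| = 2%N.
  by move: (cardsD1 i t); rewrite it t3; lia.
have : j \in (t :\ i)%SET by rewrite tD !inE eqxx.
have : k \in (t :\ i)%SET by rewrite tD !inE eqxx orbT.
rewrite !inE => /andP[ki _] /andP[ji _].
exists i, j, k; split; rewrite // 1?eq_sym //; apply/finset.setP => l.
by have := finset.setD1K it; rewrite tD => <-; rewrite !inE orbA.
Qed.

Lemma card3_third (T : finType) (t : {set T}) (i j : T) : #|t| = 3%N ->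
  i != j -> i \in t -> j \in t ->
  exists k, [/\ t = [set i; j; k]%SET, i != k & j != k].
Proof.
move=> t3 ij it jt; have jti : j \in (t :\ i)%SET by rewrite !inE eq_sym ij.
have : #|(t :\ i :\ j)%SET| == 1%N.
  by move: (cardsD1 i t) (cardsD1 j (t :\ i)%SET); rewrite it jti t3; lia.
case/cards1P => k tE; exists k.
have : k \in (t :\ i :\ j)%SET by rewrite tE !inE.
rewrite !inE => /and3P[kj ki _]; split; rewrite 1?eq_sym //.
rewrite -(finset.setD1K it) -(finset.setD1K jti) tE; apply/finset.setP => l.
by rewrite !inE orbA.
Qed.

Lemma card3_other (T : finType) (t : {set T}) (i : T) : #|t| = 3%N -> i \in t ->
  exists2 j, j \in t & i != j.
Proof.
move=> t3 it; have : (0 < #|(t :\ i)%SET|)%N by move: (cardsD1 i t); rewrite it t3; lia.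
by case/card_gt0P => j; rewrite !inE => /andP[ji jt]; exists j; rewrite // eq_sym.
Qed.

Lemma free_orient (R : realType) (a b c : 'rV[R]_2) : free [:: b - a; c - a] ->
  orient (shear 0 a) (shear 0 b) (shear 0 c) != 0.
Proof.
rewrite free_cons span_seq1 => /andP[ub]; rewrite seq1_free => v0.
apply: contra ub => /eqP; rewrite /orient /shear /= !mul0r !addr0 => e.
case: (eqVneq ((c - a) 0 0) 0) => [c0|c0].
  case: (eqVneq ((c - a) 0 1) 0) => [c1|c1].
    case/eqP: v0; apply/rowP => m; rewrite !mxE.
    case: m => [[|[|//]] hm]; [move: c0|move: c1]; rewrite !mxE => <-;
      congr (c _ _ - a _ _); exact/val_inj.
  apply/vlineP; exists ((b - a) 0 1 / (c - a) 0 1); apply/rowP => m; rewrite !mxE.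
  move: c0 c1; rewrite !mxE => c0 c1.
  case: m => [[|[|//]] hm].
    have -> : Ordinal hm = 0 by exact/val_inj.
    have /eqP := e; rewrite c0 mulr0 subr0 mulf_eq0 (negbTE c1) orbF => /eqP ->; by rewrite mulr0.
  have -> : Ordinal hm = 1 by exact/val_inj.
  by rewrite divfK.
apply/vlineP; exists ((b - a) 0 0 / (c - a) 0 0); apply/rowP => m; rewrite !mxE.
move: c0; rewrite !mxE => c0.
case: m => [[|[|//]] hm].
  have -> : Ordinal hm = 0 by exact/val_inj.
  by rewrite divfK.
have -> : Ordinal hm = 1 by exact/val_inj.
by rewrite mulrAC; apply: (mulIf c0); rewrite divfK //; lra.
Qed.

(** The coordinates are indexed by all vertices and vanish off [t], so that those relative to
    different triangles can be compared directly. *)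
Definition bary_spec (R : realType) (X : triangulation R) (t : {set 'I_(nvert X)})
    (b : 'I_(nvert X) -> 'rV[R]_2 -> R) : Prop :=
  [/\ forall x, \sum_i b i x = 1, forall x, \sum_i b i x *: pos i = x,
      forall i x, i \notin t -> b i x = 0,
      forall i, exists c0 c1 c2, forall x, b i x = c0 + c1 * x 0 0 + c2 * x 0 1
    & forall w, (forall i, i \notin t -> w i = 0) -> \sum_i w i = 1 ->
        forall i, b i (\sum_j w j *: pos j) = w i].

(* Arbitrary unless [t] is a nondegenerate triangle. *)
Definition bary (R : realType) (X : triangulation R) (t : {set 'I_(nvert X)}) :
  'I_(nvert X) -> 'rV[R]_2 -> R := get (bary_spec t).

Lemma rowP2 (R : realType) (x y : 'rV[R]_2) : x 0 0 = y 0 0 -> x 0 1 = y 0 1 -> x = y.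
Proof.
move=> e0 e1; apply/rowP => -[[|[|//]] hm].
  by have -> : Ordinal hm = 0 by exact/val_inj.
by have -> : Ordinal hm = 1 by exact/val_inj.
Qed.

(** Cramer's rule: each coordinate is the signed area obtained by replacing one vertex by [x],
    divided by the area [D] of the triangle. *)
Lemma baryP (R : realType) (X : triangulation R) (t : {set 'I_(nvert X)}) :
  triangle t -> bary_spec t (bary t).
Proof.
case=> t3 tf; apply: getPex.
have [i [j [k [tE ij ik jk]]]] := cards3_eq t3.
have D0 := free_orient (tf i j k tE).
pose o a b c := orient (shear 0 a) (shear 0 b) (shear 0 c) : R.
rewrite -/(o _ _ _) in D0; set D := o _ _ _ in D0.
pose be l (x : 'rV[R]_2) := if l == i then o (pos j) (pos k) x / D else
  if l == j then o (pos k) (pos i) x / D else if l == k then o (pos i) (pos j) x / D else 0.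
have bi x : be i x = o (pos j) (pos k) x / D by rewrite /be eqxx.
have bj x : be j x = o (pos k) (pos i) x / D by rewrite /be eqxx eq_sym (negbTE ij).
have bk x : be k x = o (pos i) (pos j) x / D.
  by rewrite /be eqxx ![k == _]eq_sym (negbTE ik) (negbTE jk).
have bn l x : l \notin t -> be l x = 0.
  by rewrite tE !inE !negb_or /be => /andP[/andP[/negbTE -> /negbTE ->] /negbTE ->].
have DE : D = o (pos i) (pos j) (pos k) by [].
exists be; split => //.
- move=> x; rewrite (sum3 ij ik jk) => [|l]; last by rewrite -tE; exact: bn.
  rewrite bi bj bk -!mulrDl; apply: (mulIf D0); rewrite divfK // mul1r DE.
  by rewrite /o /orient /shear /=; ring.
- move=> x; rewrite (sum3 ij ik jk) => [|l]; last by rewrite -tE => lt; rewrite bn // scale0r.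
  rewrite bi bj bk; apply: rowP2; rewrite !mxE;
  rewrite ![_ / D * _]mulrAC -!mulrDl; apply: (mulIf D0);
  rewrite divfK // DE /o /orient /shear /=; ring.
- have oa a b : exists c0 c1 c2, forall x : 'rV[R]_2, o a b x / D = c0 + c1 * x 0 0 + c2 * x 0 1.
    exists ((- (b 0 0 - a 0 0) * a 0 1 + (b 0 1 - a 0 1) * a 0 0) / D).
    exists (- (b 0 1 - a 0 1) / D), ((b 0 0 - a 0 0) / D) => x.
    by rewrite /o /orient /shear /=; ring.
  move=> l; rewrite /be; case: (l == i); first exact: oa.
  case: (l == j); first exact: oa.
  case: (l == k); first exact: oa.
  by exists 0, 0, 0 => x; rewrite !mul0r !addr0.
- move=> w w0 w1 l; rewrite (sum3 ij ik jk) => [|m]; last first.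
    by rewrite -tE => lt; rewrite w0 // scale0r.
  move: w1; rewrite (sum3 ij ik jk) => [w1|m]; last by rewrite -tE; exact: w0.
  have wi : w i = 1 - w j - w k by lra.
  case: (boolP (l \in t)) => [|lt]; last by rewrite bn // w0.
  rewrite tE !inE => /orP[/orP[]|] /eqP ->; rewrite ?bi ?bj ?bk; apply: (mulIf D0);
    rewrite divfK // DE /o /orient /shear /= !mxE ?wi; ring.
Qed.

Lemma segment_continuous (R : realType) (a b : 'rV[R]_2) :
  continuous (fun c : R => (1 - c) *: a + c *: b).
Proof.
move=> c; apply: (@continuousD _ _ _ (fun c : R => (1 - c) *: a) (fun c : R => c *: b));
  last exact: scalel_continuous.
apply: (@continuous_comp _ _ _ (fun c : R => 1 - c) (fun c : R => c *: a)).
  by apply: continuousB; [exact: cst_continuous|exact: id].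
exact: scalel_continuous.
Qed.

Section Hulls.
Variables (R : realType) (X : triangulation R).
Hypothesis hX : triangulated_domain X.
Implicit Types (s t S : {set 'I_(nvert X)}) (x y : 'rV[R]_2).
Local Notation pos := (@pos R X).

Lemma tri_triangle t : t \in tri X -> triangle t. Proof. by case: hX => _ _ + _ _; apply. Qed.

Lemma tri_card t : t \in tri X -> #|t| = 3%N. Proof. by case/tri_triangle. Qed.

Lemma bary_sum t x : t \in tri X -> \sum_i bary t i x = 1.
Proof. by move/tri_triangle/baryP => []. Qed.

Lemma bary_pos t x : t \in tri X -> \sum_i bary t i x *: pos i = x.
Proof. by move/tri_triangle/baryP => []. Qed.

Lemma bary_out t i x : t \in tri X -> i \notin t -> bary t i x = 0.
Proof. by move/tri_triangle/baryP => [_ _ + _ _]; apply. Qed.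

Lemma bary_uniq t (w : 'I_(nvert X) -> R) : t \in tri X ->
  (forall i, i \notin t -> w i = 0) -> \sum_i w i = 1 ->
  forall i, bary t i (\sum_j w j *: pos j) = w i.
Proof. by move/tri_triangle/baryP => [_ _ _ _]; apply. Qed.

Lemma bary_affine t i x y c : t \in tri X ->
  bary t i ((1 - c) *: x + c *: y) = (1 - c) * bary t i x + c * bary t i y.
Proof.
move/tri_triangle/baryP => [_ _ _ + _] => /(_ i) [c0 [c1 [c2 e]]].
by rewrite !e !mxE; ring.
Qed.

Lemma bary_continuous t i : t \in tri X -> continuous (bary t i).
Proof.
move/tri_triangle/baryP => [_ _ _ + _] => /(_ i) [c0 [c1 [c2 e]]].
have -> : bary t i = (cst c0 \+ (cst c1 \* (fun x : 'rV[R]_2 => x 0 0)))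
    \+ (cst c2 \* (fun x : 'rV[R]_2 => x 0 1)).
  by apply/funext => x; rewrite e.
move=> x; have cM c j : {for x, continuous (cst c \* (fun x : 'rV[R]_2 => x 0 j))}.
  by apply: continuousM; [exact: cst_continuous|exact: coord_continuous].
by apply: continuousD (cM _ _); apply: continuousD (cM _ _); exact: cst_continuous.
Qed.

Lemma hull_subset S S' : (S \subset S')%SET -> hull S `<=` hull S'.
Proof.
move=> SS x [w [w0 wS w1 ->]]; exists w; split=> // i iS.
by apply: wS; apply: contra iS; apply/fintype.subsetP.
Qed.

Lemma hull_bary t S x : t \in tri X -> (S \subset t)%SET ->
  hull S x <-> (forall i, 0 <= bary t i x) /\ (forall i, i \notin S -> bary t i x = 0).
Proof.
move=> tX St; split=> [[w [w0 wS w1 ->]]|[b0 bS]].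
  have wE := bary_uniq tX (w := w).
  by split=> i; [rewrite wE //|move=> iS; rewrite wE // ?wS //] => j jt; apply: wS;
    apply: contra jt; apply/fintype.subsetP.
by exists (fun i => bary t i x); split; rewrite ?bary_sum ?bary_pos.
Qed.

Lemma hull_tri t x : t \in tri X -> hull t x <-> (forall i, 0 <= bary t i x).
Proof.
move=> tX; split=> [/(hull_bary _ tX (subxx _)) []//|b0].
by apply/(hull_bary _ tX (subxx _)); split=> // i; exact: bary_out.
Qed.

Lemma hull_meet s t x : s \in tri X -> t \in tri X -> hull s x -> hull t x -> hull (s :&: t)%SET x.
Proof.
move=> sX tX hs ht; case: (eqVneq s t) => [->|st]; first by rewrite finset.setIid.
by case: hX => _ _ _ /(_ _ _ sX tX st) <- _.
Qed.

(* Where [t] and a face [S] of another triangle meet, they share the least face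
   of [t] containing the point. *)
Lemma bary_support s t S x i : s \in tri X -> t \in tri X -> (S \subset s)%SET ->
  hull t x -> hull S x -> bary t i x != 0 -> i \in S.
Proof.
move=> sX tX Ss ht hS; have hs := hull_subset Ss hS.
have [w [_ wst w1 xE]] := hull_meet sX tX hs ht.
have ws j : j \notin s -> w j = 0 by move=> js; apply: wst; rewrite inE negb_and js.
have wt j : j \notin t -> w j = 0 by move=> jt; apply: wst; rewrite inE negb_and jt orbT.
rewrite {1}xE (bary_uniq tX wt w1) -(bary_uniq sX ws w1) -xE; apply: contraR => iS.
by case/(hull_bary _ sX Ss): hS => _ ->.
Qed.

Lemma hull_closed t : t \in tri X -> closed (hull t).
Proof.
move=> tX; have -> : hull t = \bigcap_i (bary t i @^-1` [set r | 0 <= r]).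
  apply/seteqP; split=> x /=; first by move/(hull_tri _ tX) => h i _; exact: h.
  by move=> h; apply/(hull_tri _ tX) => i; exact: h.
apply: closed_bigI => i _; apply: closed_comp; last exact: closed_ge.
by move=> y _; exact: bary_continuous.
Qed.

Lemma bary_vertex t i j : t \in tri X -> i \in t -> bary t j (pos i) = (j == i)%:R.
Proof.
move=> tX it; have := bary_uniq (t := t) (w := fun l => (l == i)%:R) tX.
have -> : \sum_j (j == i)%:R *: pos j = pos i.
  by rewrite (bigD1 i) //= eqxx scale1r big1 ?addr0 // => l /negbTE ->; rewrite scale0r.
apply.
  by move=> l lt; case: eqP => // e; rewrite e it in lt.
by rewrite (bigD1 i) //= eqxx big1 ?addr0 // => l /negbTE ->.
Qed.

Lemma vertex_hull i S s : s \in tri X -> (S \subset s)%SET -> hull S (pos i) -> i \in S.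
Proof.
move=> sX Ss hS; case: hX => _ /(_ i) [t tX it] _ _ _.
apply: (bary_support (t := t) sX tX Ss _ hS); last by rewrite bary_vertex // eqxx oner_eq0.
by apply/(hull_tri _ tX) => j; rewrite bary_vertex // ler0n.
Qed.

End Hulls.

(** * Neighbourhoods of edges *)

Section Edges.
Variables (R : realType) (X : triangulation R).
Hypothesis hX : triangulated_domain X.
Implicit Types (s t S : {set 'I_(nvert X)}) (x y : 'rV[R]_2) (i j k l : 'I_(nvert X)).
Local Notation pos := (@pos R X).

(** Left unsimplified so that [bary_affine] and [shear_affine] apply as to any point of a
    segment. *)
Definition mid i j : 'rV[R]_2 := (1 - 2^-1) *: pos i + 2^-1 *: pos j.

Lemma bary_mid t i j l : t \in tri X -> i \in t -> j \in t ->
  bary t l (mid i j) = 2^-1 * ((l == i)%:R + (l == j)%:R).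
Proof. by move=> tX it jt; rewrite bary_affine // !bary_vertex //; field. Qed.

Lemma hull_mid i j : i != j -> hull [set i; j]%SET (mid i j).
Proof.
move=> ij; exists (fun l => 2^-1 * ((l == i)%:R + (l == j)%:R)); split.
- by move=> l; rewrite mulr_ge0 ?addr_ge0 ?ler0n // invr_ge0 ler0n.
- by move=> l; rewrite !inE negb_or => /andP[/negbTE -> /negbTE ->]; rewrite addr0 mulr0.
- rewrite (sum2 ij) => [|l].
    by rewrite !eqxx [j == i]eq_sym (negbTE ij) addr0 add0r !mulr1; field.
  by rewrite !inE negb_or => /andP[/negbTE -> /negbTE ->]; rewrite addr0 mulr0.
rewrite (sum2 ij) => [|l].
  by rewrite !eqxx [j == i]eq_sym (negbTE ij) addr0 add0r mulr1 /mid; congr (_ *: _ + _); field.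
by rewrite !inE negb_or => /andP[/negbTE -> /negbTE ->]; rewrite addr0 mulr0 scale0r.
Qed.

(** An affine function commutes with the barycentric combination expressing [x] in [s]. *)
Lemma bary_change s t l x : s \in tri X -> t \in tri X ->
  bary t l x = \sum_m bary s m x * bary t l (pos m).
Proof.
move=> sX tX; have [_ _ _ /(_ l) [c0 [c1 [c2 e]]] _] := baryP (tri_triangle hX tX).
have h m : x 0 m = \sum_l0 bary s l0 x * pos l0 0 m.
  by rewrite -{1}(bary_pos hX x sX) summxE; apply: eq_bigr => l0 _; rewrite mxE.
rewrite e !h; transitivity (c0 * \sum_m bary s m x + c1 * \sum_m bary s m x * pos m 0 0 +
    c2 * \sum_m bary s m x * pos m 0 1); first by rewrite (bary_sum hX) // mulr1.
rewrite !mulr_sumr -!big_split /=; apply: eq_bigr => m _.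
by rewrite e; ring.
Qed.

(** Both coordinates vanish on the line through [i] and [j], so they are proportional; evaluating at
    [k] gives the factor. *)
Lemma bary_across s t i j k l x : s \in tri X -> t \in tri X ->
  i != j -> i != k -> j != k -> i != l -> j != l ->
  s = [set i; j; k]%SET -> t = [set i; j; l]%SET ->
  bary t l x = bary s k x * bary t l (pos k).
Proof.
move=> sX tX ij ik jk il jl sE tE; rewrite (bary_change l x sX tX).
have it : i \in t by rewrite tE !inE eqxx.
have jt : j \in t by rewrite tE !inE eqxx orbT.
rewrite (sum3 ij ik jk) => [|m]; last by rewrite -sE => ms; rewrite bary_out // mul0r.
rewrite (bary_vertex hX _ tX it) (bary_vertex hX _ tX jt) ![l == _]eq_sym.
by rewrite (negbTE il) (negbTE jl) !mulr0 !add0r.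
Qed.

(** Otherwise a short move from the midpoint of the common edge toward [k] would stay in both
    triangles, and its positive coordinate at [k] would make [k] a vertex of [t]. *)
Lemma opposite_sides s t i j k l : s \in tri X -> t \in tri X -> s != t ->
  i != j -> i != k -> j != k -> i != l -> j != l ->
  s = [set i; j; k]%SET -> t = [set i; j; l]%SET ->
  bary t l (pos k) < 0.
Proof.
move=> sX tX st ij ik jk il jl sE tE; rewrite ltNge; apply/negP => c0.
have is_ : i \in s by rewrite sE !inE eqxx.
have js : j \in s by rewrite sE !inE eqxx orbT.
have ks : k \in s by rewrite sE !inE eqxx !orbT.
have it : i \in t by rewrite tE !inE eqxx.
have jt : j \in t by rewrite tE !inE eqxx orbT.
have kt : k \notin t.
  apply: contra st => kt; rewrite finset.eqEcard (tri_card hX sX) (tri_card hX tX) leqnn andbT.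
  by apply/fintype.subsetP => m; rewrite sE !inE => /orP[/orP[]|] /eqP ->.
pose bi := bary t i (pos k); pose bj := bary t j (pos k).
(* Small enough that the coordinates of [x] at [i] and [j] in [t], close to one half, remain
   nonnegative. *)
pose e : R := (2 + 2 * `|bi| + 2 * `|bj|)^-1.
have d0 : 0 < 2 + 2 * `|bi| + 2 * `|bj| by have := normr_ge0 bi; have := normr_ge0 bj; lra.
have e0 : 0 < e by rewrite invr_gt0.
have eE : e * (2 + 2 * `|bi| + 2 * `|bj|) = 1 by rewrite mulVf // gt_eqF.
pose x := (1 - e) *: mid i j + e *: pos k.
have nb (b : R) : 0 <= e * (`|b| + b).
  by apply: mulr_ge0; [exact: ltW|have := ler_norm (- b); rewrite normrN; lra].
have nn (b : R) : 0 <= e * `|b| by rewrite mulr_ge0 // ltW.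
have e1 : e <= 2^-1 by have := nn bi; have := nn bj; lra.
have hs : hull s x.
  apply/(hull_tri hX _ sX) => m; rewrite bary_affine // bary_mid // bary_vertex //.
  by apply: addr_ge0; apply: mulr_ge0; rewrite ?ler0n ?(ltW e0) //; lra.
have ht : hull t x.
  apply/(hull_tri hX _ tX) => m; case: (boolP (m \in t)) => [|mt]; last by rewrite bary_out.
  rewrite bary_affine // bary_mid // tE !inE -tE => /orP[/orP[]|] /eqP ->.
  - rewrite eqxx (negbTE ij) -/bi addr0 mulr1.
    by have := nb bi; have := nn bi; have := nn bj; lra.
  - rewrite eqxx eq_sym (negbTE ij) -/bj add0r mulr1.
    by have := nb bj; have := nn bi; have := nn bj; lra.
  - by rewrite ![l == _]eq_sym (negbTE il) (negbTE jl) addr0 !mulr0 add0r mulr_ge0 // ltW.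
case/negP: kt; apply: (bary_support (s := t) (t := s) hX _ _ _ hs ht) => //.
rewrite bary_affine // bary_mid // bary_vertex // ![k == _]eq_sym (negbTE ik) (negbTE jk) eqxx.
by rewrite addr0 !mulr0 add0r mulr1 gt_eqF.
Qed.

(** The third vertices would lie pairwise on opposite sides of one line, which has only two
    sides. *)
Lemma edge_at_most_two s t u i j : s \in tri X -> t \in tri X -> u \in tri X ->
  i != j -> i \in s -> j \in s -> i \in t -> j \in t -> i \in u -> j \in u ->
  [|| s == t, t == u | s == u].
Proof.
move=> sX tX uX ij is_ js it jt iu ju.
have [k [sE ik jk]] := card3_third (tri_card hX sX) ij is_ js.
have [l [tE il jl]] := card3_third (tri_card hX tX) ij it jt.
have [m [uE im jm]] := card3_third (tri_card hX uX) ij iu ju.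
apply/norP => -[st /norP[tu su]].
have h1 := opposite_sides sX tX st ij ik jk il jl sE tE.
rewrite eq_sym in tu; rewrite eq_sym in su.
have h2 := opposite_sides uX tX tu ij im jm il jl uE tE.
have h3 := opposite_sides uX sX su ij im jm ik jk uE sE.
by move: h2; rewrite (bary_across (pos m) sX tX ij ik jk il jl sE tE); nra.
Qed.

Lemma bary_near_mid t i j : t \in tri X -> i != j -> i \in t -> j \in t ->
  \forall x \near mid i j, 0 < bary t i x /\ 0 < bary t j x.
Proof.
move=> tX ij it jt.
have near_pos m : 0 < bary t m (mid i j) -> \forall x \near mid i j, 0 < bary t m x.
  move=> m0; have := bary_continuous hX (i := m) tX (x := mid i j).
  by move/(_ [set r : R | 0 < r]); apply; apply: open_nbhs_nbhs; split; first exact: open_gt.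
apply: filterI; apply: near_pos; rewrite bary_mid // eqxx.
  by rewrite (negbTE ij) addr0 mulr1 invr_gt0.
by rewrite [j == i]eq_sym (negbTE ij) add0r mulr1 invr_gt0.
Qed.

(** Near the midpoint the coordinates at [i] and [j] are positive, while those at [k] in [s] and at
    [l] in [t] have opposite signs: a nearby point is in [s] or in [t]. *)
Lemma mid_interior s t i j : s \in tri X -> t \in tri X -> s != t ->
  i != j -> i \in s -> j \in s -> i \in t -> j \in t ->
  interior (carrier X) (mid i j).
Proof.
move=> sX tX st ij is_ js it jt.
have [k [sE ik jk]] := card3_third (tri_card hX sX) ij is_ js.
have [l [tE il jl]] := card3_third (tri_card hX tX) ij it jt.
have c0 := opposite_sides sX tX st ij ik jk il jl sE tE.
rewrite /interior /=; near=> x.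
have [si sj] : 0 < bary s i x /\ 0 < bary s j x by near: x; exact: bary_near_mid.
have [ti tj] : 0 < bary t i x /\ 0 < bary t j x by near: x; exact: bary_near_mid.
case: (leP 0 (bary s k x)) => [sk|sk].
  exists s => //; apply/(hull_tri hX _ sX) => m.
  case: (boolP (m \in s)) => [|ms]; last by rewrite bary_out.
  by rewrite sE !inE -sE => /orP[/orP[]|] /eqP -> //; exact: ltW.
exists t => //; apply/(hull_tri hX _ tX) => m.
case: (boolP (m \in t)) => [|mt]; last by rewrite bary_out.
rewrite tE !inE -tE => /orP[/orP[]|] /eqP -> //; try exact: ltW.
by rewrite (bary_across x sX tX ij ik jk il jl sE tE); nra.
Unshelve. all: by end_near.
Qed.

Lemma mid_not_interior t i j : t \in tri X -> i != j -> i \in t -> j \in t ->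
  (forall s, s \in tri X -> i \in s -> j \in s -> s = t) ->
  ~ interior (carrier X) (mid i j).
Proof.
move=> tX ij it jt uniq_t; rewrite /interior /= => cm.
have [k [tE ik jk]] := card3_third (tri_card hX tX) ij it jt.
have kt : k \in t by rewrite tE !inE eqxx !orbT.
have htm : hull t (mid i j).
  by apply: hull_subset (hull_mid ij); rewrite tE; exact: finset.subsetUl.
(* The other triangles form a closed set missing the midpoint, so near the midpoint the carrier
   reduces to [t]. *)
pose K := \bigcup_(s in [set s | (s \in tri X) && (s != t)]) hull s.
have Kc : closed K.
  by apply: closed_bigcup => [|s /= /andP[sX _]]; [exact: finite_finset|exact: (hull_closed hX)].
have Km : ~ K (mid i j).
  case=> s /= /andP[sX /eqP st] hs; apply: st; apply: uniq_t => //.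
    apply: (bary_support (s := s) (t := t) hX _ _ _ htm hs) => //.
    by rewrite bary_mid // eqxx (negbTE ij) addr0 mulr1.
  apply: (bary_support (s := s) (t := t) hX _ _ _ htm hs) => //.
  by rewrite bary_mid // eqxx [j == i]eq_sym (negbTE ij) add0r mulr1.
have nK : nbhs (mid i j) (~` K) by apply: open_nbhs_nbhs; split => //; exact: closed_openC.
pose path (c : R) : 'rV[R]_2 := (1 - c) *: mid i j + c *: pos k.
have pc : {for (0 : R), continuous path} by exact: segment_continuous.
have p0 : path 0 = mid i j by rewrite /path subr0 scale1r scale0r addr0.
have : nbhs (path 0) (carrier X `&` ~` K) by rewrite p0; exact: filterI.
move/pc => /nbhs_ballP [e /= e0 he].
(* A negative parameter moves away from [k], out of [t]. *)
have [|[s sX hs] nKp] := he (- (e / 2)).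
  by rewrite /ball /= sub0r opprK ger0_norm; lra.
case: (eqVneq s t) => [st|st]; last by apply: nKp; exists s => //=; rewrite sX.
move: hs; rewrite st => /(hull_tri hX _ tX) /(_ k).
rewrite bary_affine // bary_mid // bary_vertex // ![k == _]eq_sym (negbTE ik) (negbTE jk) eqxx.
by rewrite addr0 !mulr0 add0r mulr1; lra.
Qed.

End Edges.

(** * Dual connectedness *)

(** If [A] and [B] had no common point in [D], then [D] intersected with [A] would be both open and
    closed in [D]. *)
Lemma connected_cover (T : topologicalType) (D A B : set T) : connected D ->
  closed A -> closed B -> D `<=` A `|` B ->
  D `&` A !=set0 -> D `&` B !=set0 -> exists2 p, D p & A p /\ B p.
Proof.
move=> cD cA cB cov DA [q [Dq Bq]]; apply: contrapT => nAB.
have DAE : D `&` A = D.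
  apply: cD => //; last by exists A.
  exists (~` B); first exact: closed_openC.
  apply/seteqP; split=> x [Dx hx]; split=> //.
    by move=> Bx; apply: nAB; exists x.
  by case: (cov _ Dx) => // /hx.
have [_ Aq] : (D `&` A) q by rewrite DAE.
by apply: nAB; exists q.
Qed.

Section Connectivity.
Variables (R : realType) (X : triangulation R).
Hypothesis hX : triangulated_domain X.
Implicit Types (s t S : {set 'I_(nvert X)}) (x y : 'rV[R]_2) (i j k l : 'I_(nvert X)).
Local Notation pos := (@pos R X).

Definition inner t : set 'rV[R]_2 := [set x | forall i, i \in t -> 0 < bary t i x].

Lemma inner_hull t x : t \in tri X -> inner t x -> hull t x.
Proof.
move=> tX it; apply/(hull_tri hX _ tX) => i.
by case: (boolP (i \in t)) => [/it/ltW//|iS]; rewrite bary_out.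
Qed.

Lemma inner_segment t x y c : t \in tri X -> inner t x -> inner t y -> 0 <= c <= 1 ->
  inner t ((1 - c) *: x + c *: y).
Proof.
move=> tX ix iy c01 i it; rewrite bary_affine //.
by have := ix i it; have := iy i it; move: (bary _ _ _) (bary _ _ _) => a b; nra.
Qed.

Lemma inner_open t : t \in tri X -> open (inner t).
Proof.
move=> tX; have -> : inner t =
    ~` (\bigcup_(i in [set i | i \in t]) (bary t i @^-1` [set r | r <= 0])).
  apply/seteqP; split=> x /=.
    by move=> ix [i /= it]; rewrite leNgt ix.
  move=> nx i it; rewrite ltNge; apply/negP => le0; apply: nx; exists i => //.
apply: closed_openC; apply: closed_bigcup; first exact: finite_finset.
move=> i it; apply: closed_comp; last exact: closed_le.
by move=> y _; exact: bary_continuous.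
Qed.

(** A family of points of the triangle seen from [pos i] in different directions. *)
Definition weighted i j k (c : R) : 'rV[R]_2 :=
  (1 - 2^-1) *: pos i + 2^-1 *: ((1 - c) *: pos j + c *: pos k).

Lemma inner_weighted i j k c : [set i; j; k]%SET \in tri X -> i != j -> i != k -> j != k ->
  0 < c < 1 -> inner [set i; j; k]%SET (weighted i j k c).
Proof.
move=> tX ij ik jk /andP[c0 c1] l lt; rewrite !bary_affine // !bary_vertex ?inE ?eqxx ?orbT //.
move: lt; rewrite !inE => /orP[/orP[]|] /eqP ->;
  rewrite !eqxx ?(negbTE ij) ?(negbTE ik) ?(negbTE jk).
- by rewrite /=; lra.
- by rewrite ![j == i]eq_sym (negbTE ij) /=; lra.
- by rewrite ![k == _]eq_sym (negbTE ik) (negbTE jk) /=; lra.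
Qed.

Lemma inner_nonempty t : t \in tri X -> exists x, inner t x.
Proof.
move=> tX; have [i [j [k [tE ij ik jk]]]] := cards3_eq (tri_card hX tX).
by exists (weighted i j k 2^-1); rewrite tE; apply: inner_weighted => //; rewrite -?tE //; lra.
Qed.

Lemma hull0 x : ~ hull (X := X) finset.set0 x.
Proof.
case=> w [_ w0 w1 _]; have := w1; rewrite big1 => [|i _]; last by rewrite w0 ?inE.
by move=> /eqP; rewrite eq_sym oner_eq0.
Qed.

Lemma hull1 i x : hull (X := X) [set i]%SET x -> x = pos i.
Proof.
case=> w [_ w0 w1 ->].
have w0' l : l != i -> w l = 0 by move=> li; apply: w0; rewrite inE.
move: w1; rewrite (bigD1 i) //= big1 ?addr0 // => wi.
rewrite (bigD1 i) //= big1 => [|l li]; last by rewrite w0' // scale0r.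
by rewrite wi scale1r addr0.
Qed.

(** If two inner points in different directions from [pos i] were both on the line through [pos i]
    and [u], so would be the other two vertices, against nondegeneracy. *)
Lemma noncollinear_inner t i (u : 'rV[R]_2) : t \in tri X -> i \in t -> u != pos i ->
  exists2 y, inner t y & orient (shear 0 (pos i)) (shear 0 u) (shear 0 y) != 0.
Proof.
move=> tX it ui; have [j jt ij] := card3_other (tri_card hX tX) it.
have [k [tE ik jk]] := card3_third (tri_card hX tX) ij it jt.
have D := free_orient ((tri_triangle hX tX).2 _ _ _ tE).
pose f y := orient (shear 0 (pos i)) (shear 0 u) (shear 0 y).
case: (eqVneq (f (weighted i j k 2^-1)) 0) => [e1|nz]; last first.
  exists (weighted i j k 2^-1); last exact: nz.
  by rewrite {1}tE; apply: inner_weighted; rewrite -?tE //; lra.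
case: (eqVneq (f (weighted i j k 4^-1)) 0) => [e2|nz]; last first.
  exists (weighted i j k 4^-1); last exact: nz.
  by rewrite {1}tE; apply: inner_weighted; rewrite -?tE //; lra.
have fw c : f (weighted i j k c) = 2^-1 * ((1 - c) * f (pos j) + c * f (pos k)).
  by rewrite /f /orient /shear /weighted /= !mxE; field.
have fj : f (pos j) = 0 by move: e1 e2; rewrite !fw; lra.
have fk : f (pos k) = 0 by move: e1 e2; rewrite !fw; lra.
case/eqP: ui; move: fj fk D; rewrite /f /orient /shear !mul0r !addr0 /= => fj fk.
set D := (X in X != 0) => D0.
apply: rowP2; apply: (mulIf D0); rewrite /D; [
  have := congr1 (fun r => r * (pos k 0 0 - pos i 0 0)) fj;
  have := congr1 (fun r => r * (pos j 0 0 - pos i 0 0)) fk |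
  have := congr1 (fun r => r * (pos k 0 1 - pos i 0 1)) fj;
  have := congr1 (fun r => r * (pos j 0 1 - pos i 0 1)) fk]; rewrite !mul0r; lra.
Qed.

(* A point of the connected open set [Om] lying in a triangle that satisfies [P]
   and in one that does not is a vertex. Near it, a short segment joining these
   two triangles stays in [Om] and avoids all vertices, although it must also
   contain such a point. *)
Lemma dual_connected (P : pred {set 'I_(nvert X)}) s0 : s0 \in tri X -> P s0 ->
  (forall s t, s \in tri X -> t \in tri X -> P s -> #|(s :&: t)%SET| = 2%N -> P t) ->
  forall t, t \in tri X -> P t.
Proof.
move=> s0X Ps0 Pstep t0 t0X; apply/negPn/negP => nPt0.
have [_ _ _ _ [Om [_ Oo Oc Ocl]]] := hX.
have OX : Om `<=` carrier X by rewrite -Ocl; exact: subset_closure.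
pose A := \bigcup_(s in [set s | (s \in tri X) && P s]) hull s.
pose B := \bigcup_(s in [set s | (s \in tri X) && ~~ P s]) hull s.
have cA : closed A.
  by apply: closed_bigcup => [|s /= /andP[sX _]]; [exact: finite_finset|exact: (hull_closed hX)].
have cB : closed B.
  by apply: closed_bigcup => [|s /= /andP[sX _]]; [exact: finite_finset|exact: (hull_closed hX)].
have XAB : carrier X `<=` A `|` B.
  move=> x [s sX hs]; case: (boolP (P s)) => Ps; [left|right]; exists s => //=; rewrite sX //.
(* [P] passes across common edges, so triangles on which it differs share at most one vertex. *)
have vertexAB s t x : s \in tri X -> t \in tri X -> P s -> ~~ P t -> hull s x -> hull t x ->
    exists i, [/\ x = pos i, i \in s & i \in t].
  move=> sX tX Ps nPt hs ht; have hst := hull_meet hX sX tX hs ht.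
  have st2 : #|(s :&: t)%SET| != 2%N.
    by apply: contra nPt => /eqP st2; exact: (Pstep s t).
  have st3 : (#|(s :&: t)%SET| < 3)%N.
    rewrite -(tri_card hX sX) proper_card // properE finset.subsetIl /=.
    apply: contra nPt => sub; suff -> : t = s by [].
    apply/eqP; rewrite eq_sym finset.eqEcard (tri_card hX sX) (tri_card hX tX) leqnn andbT.
    exact: fintype.subset_trans sub (finset.subsetIr _ _).
  case: (posnP #|(s :&: t)%SET|) => [/cards0_eq st0|st0].
    by move: hst; rewrite st0 => /hull0.
  have /cards1P[i stE] : #|(s :&: t)%SET| == 1%N by move: st0 st2 st3; lia.
  have : i \in (s :&: t)%SET by rewrite stE inE.
  rewrite inE => /andP[is_ it]; exists i; split=> //.
  by apply: hull1; rewrite -stE.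
have meet s : s \in tri X -> Om `&` hull s !=set0.
  move=> sX; have [x ix] := inner_nonempty sX.
  have : closure Om x by rewrite Ocl; exists s => //; exact: inner_hull.
  move/(_ (inner s)) => []; first by apply: open_nbhs_nbhs; split=> //; exact: inner_open.
  by move=> y [Oy iy]; exists y; split=> //; exact: inner_hull.
have [|||p Op [[s /= /andP[sX Ps] hs] [t /= /andP[tX nPt] ht]]] := connected_cover Oc cA cB.
- exact: subset_trans OX XAB.
- by have [x [Ox hx]] := meet _ s0X; exists x; split=> //; exists s0 => //=; rewrite s0X.
- by have [x [Ox hx]] := meet _ t0X; exists x; split=> //; exists t0 => //=; rewrite t0X.
have [i [pE is_ it]] := vertexAB _ _ _ sX tX Ps nPt hs ht.
have [u iu] := inner_nonempty sX.
have up : u != pos i.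
  apply/eqP => uE; have [j js] := card3_other (tri_card hX sX) is_.
  rewrite eq_sym => /negbTE ji; have := iu j js.
  by rewrite uE bary_vertex // ji ltxx.
(* Noncollinearity with [u] and [pos i] keeps the segment between the two triangles off the vertex
   itself. *)
have [v iv uv] := noncollinear_inner tX it up.
pose K := \bigcup_(j in [set j | j != i]) [set pos j].
have Kc : closed K.
  apply: closed_bigcup => [|j _]; first exact: finite_finset.
  exact/accessible_closed_set1/hausdorff_accessible/norm_hausdorff.
have nK : ~ K p.
  by case=> j /= ji; rewrite pE => e; case: hX => inj _ _ _ _; rewrite (inj _ _ e) eqxx in ji.
have : nbhs p (Om `&` ~` K).
  by apply: filterI; apply: open_nbhs_nbhs; split=> //; exact: closed_openC.
rewrite nbhs_ballP => -[r /= r0 hr].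
(* Every [h c] with [c] between 0 and 1 is within [e * M] of [p]; the bound [e <= 1] keeps the ends
   [x] and [y] in their triangles. *)
pose M := 1 + `|u - p| + `|v - p|.
have M1 : 1 <= M by rewrite /M -addrA lerDl addr_ge0.
have M0 : 0 < M by lra.
pose e := Num.min 1 (r / 2 / M).
have e0 : 0 < e by rewrite lt_min ltr01 !divr_gt0.
have e1 : e <= 1 by rewrite ge_min lexx.
have eM : e * M < r.
  have : e <= r / 2 / M by rewrite ge_min lexx orbT.
  by rewrite ler_pdivlMr //; lra.
pose x := (1 - e) *: p + e *: u; pose y := (1 - e) *: p + e *: v.
pose h (c : R) := (1 - c) *: x + c *: y.
have hE c : h c = p + e *: ((1 - c) *: (u - p) + c *: (v - p)).
  by apply: rowP2; rewrite !mxE; ring.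
have hN c : 0 <= c <= 1 -> (Om `&` ~` K) (h c).
  move=> /andP[c0 c1]; apply: hr; rewrite -ball_normE /= hE opprD addNKr normrN normrZ gtr0_norm //.
  apply: le_lt_trans eM; rewrite ler_wpM2l ?(ltW e0) //.
  apply: (le_trans (ler_normD _ _)); rewrite !normrZ !ger0_norm ?subr_ge0 //.
  have := normr_ge0 (u - p); have := normr_ge0 (v - p); rewrite /M.
  by move: `|u - p| `|v - p| => a b; nra.
have hp c : h c != p.
  apply: contra uv => /eqP hc.
  have w0 : (1 - c) *: (u - p) + c *: (v - p) = 0.
    apply: (@scalerI _ _ e); first by rewrite gt_eqF.
    by rewrite scaler0; apply: (addrI p); rewrite -hE hc addr0.
  have : (1 - c) * (u 0 0 - p 0 0) + c * (v 0 0 - p 0 0) = 0.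
    by move/rowP: w0 => /(_ 0); rewrite !mxE.
  have : (1 - c) * (u 0 1 - p 0 1) + c * (v 0 1 - p 0 1) = 0.
    by move/rowP: w0 => /(_ 1); rewrite !mxE.
  move=> h1 h0; rewrite -pE /orient /shear /= !mul0r !addr0; apply/eqP.
  transitivity (((1 - c) * (u 0 0 - p 0 0) + c * (v 0 0 - p 0 0)) *
      ((v 0 1 - p 0 1) - (u 0 1 - p 0 1)) -
    ((1 - c) * (u 0 1 - p 0 1) + c * (v 0 1 - p 0 1)) *
      ((v 0 0 - p 0 0) - (u 0 0 - p 0 0))); first by ring.
  by rewrite h0 h1 !mul0r subr0.
have hc : continuous h by exact: segment_continuous.
have cl C : closed C -> closed (h @^-1` C) by move=> ?; apply: closed_comp => // z _; exact: hc.
have [|||c c01 [[s1 /= /andP[s1X Ps1] hs1] [t1 /= /andP[t1X nPt1] ht1]]] :=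
   connected_cover (@segment_connected R 0 1) (cl _ cA) (cl _ cB).
- move=> c /=; rewrite in_itv /= => /hN [Oh _]; exact/XAB/OX.
- exists 0; split; first by rewrite /= in_itv /= lexx ler01.
  rewrite /= /h subr0 scale1r scale0r addr0; exists s => /=; first by rewrite sX.
  apply/(hull_tri hX _ sX) => l; rewrite bary_affine // pE bary_vertex //.
  have := (hull_tri hX _ sX).1 (inner_hull sX iu) l.
  by have : 0 <= (l == i)%:R :> R by []; move: (_ %:R) (bary _ _ _) => a b; nra.
- exists 1; split; first by rewrite /= in_itv /= lexx ler01.
  rewrite /= /h subrr scale1r scale0r add0r; exists t => /=; first by rewrite tX.
  apply/(hull_tri hX _ tX) => l; rewrite bary_affine // pE bary_vertex //.
  have := (hull_tri hX _ tX).1 (inner_hull tX iv) l.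
  by have : 0 <= (l == i)%:R :> R by []; move: (_ %:R) (bary _ _ _) => a b; nra.
have [j [hj _ _]] := vertexAB _ _ _ s1X t1X Ps1 nPt1 hs1 ht1.
move: c01; rewrite /= in_itv /= => /hN [_]; apply; rewrite hj.
by exists j => //=; apply/eqP => ji; have := hp c; rewrite hj pE ji eqxx.
Qed.
End Connectivity.

(** * Even sets of edges are boundaries *)

(** Two points with different ordinates become aligned for a single [c], whose absolute value is
    [r]; the chosen [c] exceeds all of these. With equal ordinates the quotient is 0 by convention,
    and distinct points are never aligned. *)
Lemma shear_generic (R : realType) (n : nat) (p : 'I_n -> 'rV[R]_2) : injective p ->
  exists c, forall i j, i != j -> (shear c (p i)).1 != (shear c (p j)).1.
Proof.
move=> inj; pose r (ij : 'I_n * 'I_n) :=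
  `|(p ij.1 0 0 - p ij.2 0 0) / (p ij.1 0 1 - p ij.2 0 1)|.
exists (1 + \sum_ij r ij) => i j; apply: contra => /eqP; rewrite /shear /= => e.
set c := 1 + _ in e; have rc : r (i, j) < c.
  rewrite /c (bigD1 (i, j)) //=.
  have : 0 <= \sum_(k | k != (i, j)) r k by apply: sumr_ge0 => k _; exact: normr_ge0.
  by lra.
case: (eqVneq (p i 0 1) (p j 0 1)) => [e1|ne1].
  by apply/eqP/inj/rowP2 => //; rewrite e1 in e; exact: addIr e.
have d0 : p i 0 1 - p j 0 1 != 0 by rewrite subr_eq0.
move: rc; rewrite /r /=.
have -> : (p i 0 0 - p j 0 0) / (p i 0 1 - p j 0 1) = - c.
  by apply: (mulIf d0); rewrite divfK //; lra.
by rewrite normrN => /(le_lt_trans (ler_norm c)); rewrite ltxx.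
Qed.

Section Parity.
Variables (R : realType) (X : triangulation R).
Hypothesis hX : triangulated_domain X.
Implicit Types (s t S : {set 'I_(nvert X)}) (x y : 'rV[R]_2) (i j k l : 'I_(nvert X)).
Implicit Types a b : edge X.
Local Notation pos := (@pos R X).

Definition ends a : {set 'I_(nvert X)} := [set (val a).1; (val a).2]%SET.

Lemma ends_neq a : (val a).1 != (val a).2.
Proof. by have /andP[lt _] := valP a; apply: contraTneq lt => ->; rewrite ltnn. Qed.

Lemma ends_tri a : exists2 t, t \in tri X & (ends a \subset t)%SET.
Proof.
have /andP[_ /andP[_ /existsP[t /and3P[tX a1 a2]]]] := valP a.
by exists t => //; apply/fintype.subsetP => i; rewrite !inE => /orP[] /eqP ->.
Qed.

Lemma ends_inj : injective ends.
Proof.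
move=> a b e; apply/val_inj; have /andP[la _] := valP a; have /andP[lb _] := valP b.
have : (val a).1 \in ends b by rewrite -e !inE eqxx.
have : (val a).2 \in ends b by rewrite -e !inE eqxx orbT.
rewrite !inE; case: (val a) (val b) la lb => [i j] [k l] /= ij kl.
by case/orP=> /eqP ? /orP[] /eqP ?; subst => //; lia.
Qed.

(** A point of the open triangle has three nonzero coordinates, and an edge through it would contain
    all three vertices. *)
Lemma inner_edge t a x : t \in tri X -> inner t x -> ~ hull (ends a) x.
Proof.
move=> tX ix ha; have [s sX as_] := ends_tri a.
have : (t \subset ends a)%SET.
  apply/fintype.subsetP => i it; apply: (bary_support hX sX tX as_ (inner_hull hX tX ix) ha).
  by rewrite gt_eqF // ix.
move/subset_leq_card; rewrite (tri_card hX tX) cards2; by case: eqP.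
Qed.

(** The sum is taken in the field with two elements, hence a parity. *)
Definition crossings (c : R) (z : edge X -> bool) x : bool :=
  \sum_a z a * above (shear c x) (shear c (pos (val a).1)) (shear c (pos (val a).2)).

Lemma shear_inj (c : R) : injective (shear c).
Proof.
move=> x y; rewrite /shear => -[e0 e1]; apply: rowP2 => //.
by rewrite e1 in e0; exact: addIr e0.
Qed.

Lemma shear_affine (c r : R) x y :
  (shear c ((1 - r) *: x + r *: y)).1 = (1 - r) * (shear c x).1 + r * (shear c y).1 /\
  (shear c ((1 - r) *: x + r *: y)).2 = (1 - r) * (shear c x).2 + r * (shear c y).2.
Proof. by rewrite /shear /= !mxE; split; ring. Qed.

Lemma uncrossed (c : R) a x y : (shear c x).1 <= (shear c y).1 ->
  (forall r, 0 <= r <= 1 -> ~ hull (ends a) ((1 - r) *: x + r *: y)) ->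
  above (shear c x) (shear c (pos (val a).1)) (shear c (pos (val a).2)) (+)
  above (shear c y) (shear c (pos (val a).1)) (shear c (pos (val a).2)) =
  overlies (shear c x) (shear c y) (shear c (pos (val a).1)) (+)
  overlies (shear c x) (shear c y) (shear c (pos (val a).2)).
Proof.
move=> xy nc; apply: above_uncrossed => // q r /andP[q0 q1] r01 e1 e2.
apply: (nc r r01); have <- : (1 - q) *: pos (val a).1 + q *: pos (val a).2 = (1 - r) *: x + r *: y.
  apply: (@shear_inj c); have [f1 f2] := shear_affine c q (pos (val a).1) (pos (val a).2).
  have [g1 g2] := shear_affine c r x y.
  by apply: injective_projections; rewrite ?f1 ?f2 ?g1 ?g2.
have an := ends_neq a.
exists (fun l => if l == (val a).1 then 1 - q else if l == (val a).2 then q else 0); split.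
- by move=> l; case: ifP => _; [lra|case: ifP => _; lra].
- by move=> l; rewrite !inE negb_or => /andP[/negbTE -> /negbTE ->].
- rewrite (sum2 an) => [|l]; first by rewrite !eqxx eq_sym (negbTE an); ring.
  by rewrite !inE negb_or => /andP[/negbTE -> /negbTE ->].
- rewrite (sum2 an) => [|l]; first by rewrite !eqxx eq_sym (negbTE an).
  by rewrite !inE negb_or => /andP[/negbTE -> /negbTE ->]; rewrite scale0r.
Qed.

(** The count changes, for each edge of [z], by the number of its ends overlying the path. Regrouped
    by vertices, each vertex contributes its degree in [z], which is even. *)
Lemma crossings_const (c : R) z x y :
  (forall v, \sum_a z a * (v \in ends a) = 0) ->
  (forall a r, 0 <= r <= 1 -> ~ hull (ends a) ((1 - r) *: x + r *: y)) ->
  crossings c z x = crossings c z y.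
Proof.
move=> even; wlog xy : x y / (shear c x).1 <= (shear c y).1.
  move=> W nc; have [xy|/ltW xy] := leP (shear c x).1 (shear c y).1; first exact: W.
  apply/esym/W => // a r r01; rewrite addrC -{1}[r](subKr 1) => h.
  by apply: (nc a (1 - r)) h; lra.
move=> nc; apply/eqP; rewrite -addr_eq0 -[_ == 0]/(_ == false :> bool).
rewrite -big_split /=.
pose o v := overlies (shear c x) (shear c y) (shear c (pos v)).
transitivity ((\sum_v o v * \sum_a z a * (v \in ends a)) == 0); last first.
  by rewrite big1 ?eqxx // => v _; rewrite even mulr0.
congr (_ == _); under [RHS]eq_bigr do rewrite mulr_sumr.
rewrite [RHS]exchange_big /=; apply: eq_bigr => a _.
rewrite -mulrDr; have := uncrossed xy (nc a); rewrite -/(o _) -/(o _) => e.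
rewrite -[_ + _]/(_ (+) _) e; under eq_bigr do rewrite mulrCA.
rewrite -mulr_sumr; congr (_ * _); rewrite (sum2 (ends_neq a)) => [|l].
  by rewrite !inE !eqxx orbT !mulr1.
by move/negbTE; rewrite /ends => ->; rewrite mulr0.
Qed.

Lemma crossings_inner (c : R) z t x y : t \in tri X ->
  (forall v, \sum_a z a * (v \in ends a) = 0) -> inner t x -> inner t y ->
  crossings c z x = crossings c z y.
Proof.
move=> tX even ix iy; apply: crossings_const => // a r r01.
exact/(inner_edge tX)/(inner_segment hX).
Qed.

(** The vector that [shear c] sends to the upward unit vector. *)
Definition vertical (c : R) : 'rV[R]_2 := \row_m (if m == 0 then - c else 1).

Lemma shear_vertical (c r : R) x :
  shear c (x + r *: vertical c) = ((shear c x).1, (shear c x).2 + r).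
Proof.
rewrite /shear !mxE /=; congr (_, _); last by rewrite mulr1.
by rewrite mulr1; ring.
Qed.

Lemma bary_line t l x y (r : R) : t \in tri X ->
  bary t l (x + r *: y) = (1 - r) * bary t l x + r * bary t l (x + y).
Proof.
move=> tX; rewrite -bary_affine //; congr (bary _ _ _).
by apply: rowP2; rewrite !mxE; ring.
Qed.

Lemma inner_near_mid t i j k x : t \in tri X -> t = [set i; j; k]%SET ->
  i != j -> i != k -> j != k -> 0 < bary t k (mid i j + x) ->
  \forall r \near 0^'+, inner t (mid i j + r *: x).
Proof.
move=> tX tE ij ik jk k0.
have it : i \in t by rewrite tE !inE eqxx.
have jt : j \in t by rewrite tE !inE eqxx orbT.
have pc : {for (0 : R), continuous (fun r : R => mid i j + r *: x)}.
  apply: continuousD; first exact: cst_continuous.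
  exact: scalel_continuous.
have nb : \forall r \near 0^'+, 0 < bary t i (mid i j + r *: x) /\ 0 < bary t j (mid i j + r *: x).
  have := cvg_at_right_filter pc; rewrite scale0r addr0 => pc0.
  exact: (pc0 _ (bary_near_mid hX tX ij it jt)).
near=> r; have r0 : 0 < r by near: r; exact: nbhs_right_gt.
have [ri rj] : 0 < bary t i (mid i j + r *: x) /\ 0 < bary t j (mid i j + r *: x) by near: r.
move=> l; rewrite {1}tE !inE => /orP[/orP[]|] /eqP -> //.
rewrite bary_line // bary_mid // ![k == _]eq_sym (negbTE ik) (negbTE jk) addr0 !mulr0 add0r.
exact: mulr_gt0.
Unshelve. all: by end_near.
Qed.

Lemma above_mid (c r : R) i j : (shear c (pos i)).1 != (shear c (pos j)).1 ->
  above (shear c (mid i j + r *: vertical c)) (shear c (pos i)) (shear c (pos j)) = (r < 0).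
Proof.
move=> ij; rewrite shear_vertical /above /orient.
have [-> ->] := shear_affine c 2^-1 (pos i) (pos j).
move: (shear c (pos i)) (shear c (pos j)) ij => [p1 p2] [q1 q2] /= pq.
have -> : (p1 <= (1 - 2^-1) * p1 + 2^-1 * q1) (+) (q1 <= (1 - 2^-1) * p1 + 2^-1 * q1).
  by move: pq; rewrite neq_lt => /orP[] pq; case: leP => h1; case: leP => h2 //; lra.
have -> : (q1 - p1) * ((q1 - p1) * ((1 - 2^-1) * p2 + 2^-1 * q2 + r - p2) -
   (q2 - p2) * ((1 - 2^-1) * p1 + 2^-1 * q1 - p1)) = (q1 - p1) ^+ 2 * r by field.
by rewrite pmulr_rlt0 // exprn_even_gt0 //= subr_eq0 eq_sym.
Qed.

(** The count is compared at two points just above and just below the midpoint of [a]: only [a] is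
    met by the short segment joining them, so only its contribution changes. *)
Lemma crossings_across (c : R) z s t a :
  (forall i j, i != j -> (shear c (pos i)).1 != (shear c (pos j)).1) ->
  (forall v, \sum_b z b * (v \in ends b) = 0) ->
  s \in tri X -> t \in tri X -> s != t ->
  (ends a \subset s)%SET -> (ends a \subset t)%SET ->
  forall x y, inner s x -> inner t y -> z a = crossings c z x + crossings c z y.
Proof.
move=> gen even sX tX st as_ at_ x y ix iy.
set i := (val a).1; set j := (val a).2; have ij : i != j := ends_neq a.
have sub (u : {set 'I_(nvert X)}) : (ends a \subset u)%SET -> i \in u /\ j \in u.
  by move=> h; split; apply: (fintype.subsetP h); rewrite !inE eqxx ?orbT.
have [is_ js] := sub _ as_; have [it jt] := sub _ at_.
have [k [sE ik jk]] := card3_third (tri_card hX sX) ij is_ js.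
have [l [tE il jl]] := card3_third (tri_card hX tX) ij it jt.
pose v := vertical c.
(* By symmetry [s] is the triangle lying above the edge. *)
wlog kv : s t k l x y sX tX st as_ at_ ix iy sE tE is_ js it jt ik jk il jl /
    0 < bary s k (mid i j + v).
  move=> W; case: (ltrgtP 0 (bary s k (mid i j + v))) => [kv|kv|kv].
  - exact: (W s t k l).
  - rewrite addrC; rewrite eq_sym in st; apply: (W t s l k) => //.
    rewrite (bary_across hX _ sX tX ij ik jk il jl sE tE).
    by rewrite nmulr_rgt0 // (opposite_sides hX sX tX _ ij ik jk il jl sE tE) // eq_sym.
  (* A zero coordinate would make the vertical direction parallel to the edge, against the choice of
     [c]. *)
  have := bary_pos hX (mid i j + v) sX; rewrite (sum3 ij ik jk) => [|m]; last first.
    by rewrite -sE => ms; rewrite bary_out // scale0r.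
  rewrite -kv scale0r addr0.
  have := bary_sum hX (mid i j + v) sX; rewrite (sum3 ij ik jk) => [|m]; last first.
    by rewrite -sE => ms; rewrite bary_out.
  rewrite -kv addr0; move: (bary _ _ _) (bary _ _ _) => q p pq.
  have -> : p = 1 - q by lra.
  move=> e; have [f1 f2] := shear_affine c q (pos i) (pos j).
  have := shear_vertical c 1 (mid i j); rewrite scale1r -/v -e => g.
  move: f1 f2; rewrite g -[fst (_, _)]/(shear c (mid i j)).1.
  rewrite -[snd (_, _)]/((shear c (mid i j)).2 + 1) => f1 f2.
  have [h1 h2] := shear_affine c 2^-1 (pos i) (pos j); rewrite -/(mid i j) in h1 h2.
  have /eqP : (q - 2^-1) * ((shear c (pos j)).1 - (shear c (pos i)).1) = 0.
    by move: f1; rewrite h1; lra.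
  rewrite mulf_eq0 subr_eq0 [_ - _ == 0]subr_eq0 [X in _ || X]eq_sym (negbTE (gen _ _ ij)) orbF.
  by move/eqP => qE; move: f2; rewrite h2 qE; lra.
have lv : 0 < bary t l (mid i j + - v).
  have := bary_line l (mid i j) v (-1) tX; rewrite scaleN1r => ->.
  rewrite bary_mid // ![l == _]eq_sym (negbTE il) (negbTE jl) addr0 !mulr0 add0r.
  rewrite (bary_across hX _ sX tX ij ik jk il jl sE tE).
  have := opposite_sides hX sX tX st ij ik jk il jl sE tE.
  by move: (bary t l (pos k)) => w w0; rewrite mulN1r oppr_gt0 pmulr_rlt0.
have [r [r0 [isr itr]]] : exists r,
    0 < r /\ inner s (mid i j + r *: v) /\ inner t (mid i j + r *: - v).
  have hs := inner_near_mid sX sE ij ik jk kv; have ht := inner_near_mid tX tE ij il jl lv.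
  by have [r []] := filter_ex (filterI (nbhs_right_gt 0) (filterI hs ht)); exists r.
rewrite (crossings_inner c sX even ix isr) (crossings_inner c tX even iy itr).
have toward u w th : u \in tri X -> i \in u -> j \in u -> inner u (mid i j + w) -> 0 < th <= 1 ->
    inner u (mid i j + th *: w).
  move=> uX iu ju iw /andP[th0 th1] m mu; rewrite bary_line // ltr_wpDl ?mulr_gt0 ?iw //.
  by rewrite mulr_ge0 ?subr_ge0 // bary_mid // mulr_ge0 ?addr_ge0 ?ler0n // invr_ge0.
rewrite /crossings -big_split /= (bigD1 a) //= -/i -/j.
rewrite scalerN -scaleNr !above_mid ?gen // oppr_lt0 r0 ltNge (ltW r0) /=.
rewrite -mulrDr add0r mulr1 big1 ?addr0 // => b ba.
rewrite -mulrDr; set e := (_ + _); suff -> : e = 0 by rewrite mulr0.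
rewrite /e -[_ + _]/(_ (+) _) uncrossed.
- rewrite /overlies !shear_vertical /=.
  by do 2 (case: ltP => //= ?; rewrite leNgt; case: ltP => //=); lra.
- by rewrite !shear_vertical.
move=> q /andP[q0 q1]; set w := (X in hull _ X).
have -> : w = mid i j + ((1 - 2 * q) * r) *: v by apply: rowP2; rewrite /w !mxE; ring.
(* The upper half of the segment is inside [s] and the lower half inside [t]; at the midpoint
   itself, [a] is the only edge. *)
case: (ltrgtP 0 (1 - 2 * q)) => [h|h|<-].
- rewrite -scalerA; apply: (inner_edge sX); apply: toward => //; lra.
- rewrite -[1 - 2 * q]opprK mulNr scaleNr -scalerN -scalerA.
  by apply: (inner_edge tX); apply: toward => //; lra.
rewrite mul0r scale0r addr0 => hb; case/eqP: ba.
have [u uX bu] := ends_tri b.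
have hs : hull s (mid i j).
  by apply: hull_subset (hull_mid ij); apply/fintype.subsetP => m; rewrite !inE => /orP[] /eqP ->.
have inb m : m \in ends a -> m \in ends b.
  move=> ma; apply: (bary_support hX uX sX bu hs hb); rewrite bary_mid //.
  move: ma; rewrite !inE -/i -/j => /orP[] /eqP ->; rewrite eqxx.
    by rewrite (negbTE ij) addr0 mulr1 invr_eq0.
  by rewrite [j == i]eq_sym (negbTE ij) add0r mulr1 invr_eq0.
apply/esym/ends_inj/eqP; rewrite finset.eqEcard !cards2 !ends_neq leqnn andbT.
exact/fintype.subsetP.
Qed.

Lemma even_potential z : (forall v, \sum_b z b * (v \in ends b) = 0) ->
  exists f : {set 'I_(nvert X)} -> bool, forall s t a,
    s \in tri X -> t \in tri X -> s != t ->
    (ends a \subset s)%SET -> (ends a \subset t)%SET -> z a = f s + f t.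
Proof.
move=> even; have [inj _ _ _ _] := hX; have [c gen] := shear_generic inj.
exists (fun t => crossings c z (get (inner t))) => s t a sX tX st as_ at_.
have ig u : u \in tri X -> inner u (get (inner u)).
  by move=> uX; have [x ix] := inner_nonempty hX uX; exact: (getPex (ex_intro _ x ix)).
by apply: (crossings_across gen even sX tX st as_ at_); exact: ig.
Qed.

End Parity.

(** * Faces, edges and corners *)

Lemma next_neq_prev (T : eqType) (c : seq T) x : uniq c -> (3 <= size c)%N -> x \in c ->
  next c x != prev c x.
Proof.
move=> uc c3 xc; apply/eqP => np; have nn : next c (next c x) = x by rewrite np next_prev.
case/rot_to: (xc) => n c' rE; move: nn; rewrite -!(next_rot n uc) rE.
have : uniq (x :: c') by rewrite -rE rot_uniq.
have : (3 <= size (x :: c'))%N by rewrite -rE size_rot.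
case: c' {rE} => [|y [|y' c']] //= _; rewrite eqxx !inE !negb_or.
move=> /andP[/and3P[xy xy' _] _]; rewrite eq_sym (negbTE xy) eqxx => e.
by rewrite e eqxx in xy'.
Qed.

Lemma cycle_constant (T : eqType) (c : seq T) (P : T -> bool) : uniq c ->
  (forall x, x \in c -> P (next c x) = P x) -> {in c &, forall x y, P x = P y}.
Proof.
move=> uc Pn; have : cycle (fun x y => P x == P y) c.
  by apply: cycle_from_next => // x xc; rewrite Pn.
case: c {uc Pn} => //= z c /order_path_min.
have tr : transitive (fun x y => P x == P y) by move=> a b d /eqP -> /eqP ->.
move=> /(_ tr); rewrite all_rcons => /andP[_ /allP h].
have hz x : x \in z :: c -> P x = P z by rewrite inE => /predU1P[->//|/h /eqP ->].
by move=> x y xc yc; rewrite !hz.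
Qed.


Section Faces.
Variables (R : realType) (X : triangulation R) (g : nat).
Variable gamma : 'I_g.+1 -> seq 'I_(nvert X).
Hypothesis hX : triangulated_domain X.
Hypothesis hgamma : bounded_by gamma.
Implicit Types (s t S : {set 'I_(nvert X)}) (i j k l v w : 'I_(nvert X)).
Implicit Types (a b : edge X) (c : 'I_g.+1).
Local Notation pos := (@pos R X).
Local Notation adjacent := (@Defs.adjacent R X).

Definition link c S : bool := has (fun k => S == [set k; next (gamma c) k]%SET) (gamma c).

Definition face : finType := ({t : {set 'I_(nvert X)} | t \in tri X} + 'I_g.+1)%type.

Definition on_face (f : face) a : bool :=
  match f with inl t => (ends a \subset val t)%SET | inr c => link c (ends a) end.

Definition corners (f : face) : {set 'I_(nvert X)} :=
  match f with inl t => val t | inr c => [set x in gamma c]%SET end.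

Lemma gamma_size c : (3 <= size (gamma c))%N.
Proof. by case: hgamma => /(_ c) []. Qed.

Lemma gamma_inhabited c : exists k, k \in gamma c.
Proof. by move: (gamma_size c); case: (gamma c) => // k s _; exists k; rewrite inE eqxx. Qed.

Lemma gamma_uniq c : uniq (gamma c).
Proof. by case: hgamma => /(_ c) []. Qed.

Lemma gamma_adjacent c k : k \in gamma c -> adjacent k (next (gamma c) k).
Proof. by case: hgamma => /(_ c) [_ _ h] _ _ _ _; exact: next_cycle. Qed.

Lemma adjacentC i j : adjacent i j = adjacent j i.
Proof.
rewrite /adjacent eq_sym; congr (_ && _); apply: eq_existsb => t.
by rewrite [(i \in t) && _]andbC.
Qed.

Lemma tri_adjacent t i j : t \in tri X -> i \in t -> j \in t -> i != j -> adjacent i j.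
Proof. by move=> tX it jt ij; rewrite /adjacent ij; apply/existsP; exists t; rewrite tX it jt. Qed.

Lemma edge_exists i j : adjacent i j -> exists a, ends a = [set i; j]%SET.
Proof.
wlog ij : i j / (i < j)%N.
  move=> W aij; have /andP[] := aij; rewrite neq_ltn => /orP[] lt _; first exact: W.
  by rewrite adjacentC in aij; have [a aE] := W _ _ lt aij; exists a; rewrite aE finset.setUC.
move=> aij; have h : ((i, j).1 < (i, j).2)%N && adjacent (i, j).1 (i, j).2 by rewrite ij.
by exists (Sub (i, j) h); rewrite /ends SubK.
Qed.

Lemma set2_inj v w w' : [set v; w]%SET = [set v; w']%SET -> w = w'.
Proof.
move=> e; have : w \in [set v; w']%SET by rewrite -e !inE eqxx orbT.
have : w' \in [set v; w]%SET by rewrite e !inE eqxx orbT.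
by rewrite !inE => /orP[/eqP ->|/eqP -> //] /orP[] /eqP.
Qed.

Lemma ends_adjacent a v : v \in ends a -> exists2 w, adjacent v w & ends a = [set v; w]%SET.
Proof.
have /andP[_ adj] := valP a; rewrite !inE => /orP[] /eqP ->.
  by exists (val a).2.
by exists (val a).1; rewrite 1?adjacentC // /ends finset.setUC.
Qed.

(** An edge at [v] is counted through its other end, which turns degrees into numbers of
    neighbours. *)
Lemma card_edges_at (Q : pred {set 'I_(nvert X)}) v :
  #|[pred a : edge X | Q (ends a) && (v \in ends a)]| =
  #|[pred w | adjacent v w && Q [set v; w]%SET]|.
Proof.
(* The default [v] is reached only by edges that miss [v]. *)
pose other a := odflt v [pick w | ends a == [set v; w]%SET].
have otherE a w : ends a = [set v; w]%SET -> other a = w.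
  move=> aE; rewrite /other; case: pickP => [w' /eqP e|/(_ w)]; last by rewrite aE eqxx.
  by apply: (@set2_inj v); rewrite -e -aE.
rewrite -(@card_in_image _ _ other) => [|a b].
  apply: eq_card => w; apply/fintype.imageP/idP => [[a]|]; rewrite inE; last first.
    move=> /andP[vw Qw]; have [a aE] := edge_exists vw; exists a; last by rewrite (otherE a w).
    by rewrite inE aE Qw !inE eqxx.
  move=> /andP[Qa /ends_adjacent [w' vw' aE]] ->.
  by rewrite inE (otherE a w') // vw' -aE.
rewrite inE => /andP[_ /ends_adjacent [w _ aE]]; rewrite inE => /andP[_ /ends_adjacent [w' _ bE]].
by rewrite (otherE _ _ aE) (otherE _ _ bE) => e; apply: ends_inj; rewrite aE bE e.
Qed.

Lemma link_next c k : k \in gamma c -> link c [set k; next (gamma c) k]%SET.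
Proof. by move=> kc; apply/hasP; exists k. Qed.

Lemma link_mem c v w : link c [set v; w]%SET -> v != w ->
  v \in gamma c /\ (w = next (gamma c) v \/ w = prev (gamma c) v).
Proof.
case/hasP => k kc /eqP e vw.
have : v \in [set k; next (gamma c) k]%SET by rewrite -e !inE eqxx.
have : w \in [set k; next (gamma c) k]%SET by rewrite -e !inE eqxx orbT.
rewrite !inE => /orP[] /eqP wE /orP[] /eqP vE; subst v w => //; rewrite ?eqxx // in vw *.
  by rewrite mem_next prev_next ?gamma_uniq //; split=> //; right.
by split=> //; left.
Qed.

(** A corner has two neighbours on its face: the other two vertices of a triangle, or the successor
    and predecessor on a curve, distinct because the curve has at least three vertices. *)
Lemma corner_degree f v : #|[pred a | on_face f a && (v \in ends a)]| = (2 * (v \in corners f))%N.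
Proof.
case: f => [[t tX]|c] /=.
  rewrite (card_edges_at (fun S => S \subset t)%SET v).
  case: (boolP (v \in t)) => vt; last first.
    rewrite muln0; apply: eq_card0 => w; rewrite !inE finset.subUset !finset.sub1set (negbTE vt).
    by rewrite andbF.
  have [w1 w1t vw1] := card3_other (tri_card hX tX) vt.
  have [w2 [tE vw2 w12]] := card3_third (tri_card hX tX) vw1 vt w1t.
  have <- : #|[set w1; w2]%SET| = (2 * true)%N by rewrite cards2 w12.
  apply: eq_card => w; rewrite !inE finset.subUset !finset.sub1set vt /=.
  apply/andP/orP => [[/andP[vw _]]|].
    by rewrite tE !inE [w == v]eq_sym (negbTE vw) /= => /orP.
  case=> /eqP ->; first by rewrite (tri_adjacent tX).
  have w2t : w2 \in t by rewrite tE !inE eqxx !orbT.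
  by rewrite (tri_adjacent tX).
rewrite (card_edges_at (link c) v) inE.
case: (boolP (v \in gamma c)) => vc; last first.
  rewrite muln0; apply: eq_card0 => w; rewrite !inE; apply: contraNF vc => /andP[/andP[vw _]].
  by case/link_mem.
have <- : #|[set next (gamma c) v; prev (gamma c) v]%SET| = (2 * true)%N.
  by rewrite cards2 next_neq_prev ?gamma_uniq ?gamma_size.
apply: eq_card => w; rewrite !inE; apply/andP/orP => [[/andP[vw _]]|].
  by case/link_mem => // _ [->|->]; rewrite eqxx; [left|right].
case=> /eqP ->; first by rewrite gamma_adjacent // link_next.
have pc : prev (gamma c) v \in gamma c by rewrite mem_prev.
have := gamma_adjacent pc; have := link_next pc; rewrite next_prev ?gamma_uniq //.
by rewrite adjacentC finset.setUC.
Qed.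

Lemma link_hull c S : link c S -> exists s,
  [/\ s \in tri X, (S \subset s)%SET & hull S `<=` curve_set (gamma c)].
Proof.
case/hasP => k kc /eqP ->; have /andP[_ /existsP[s /and3P[sX ks ns]]] := gamma_adjacent kc.
exists s; split=> //; first by rewrite finset.subUset !finset.sub1set ks.
by move=> x hx; exists k.
Qed.

Lemma curve_frontier c : curve_set (gamma c) `<=` ~` interior (carrier X).
Proof.
case: hgamma => _ _ fr _ _ x cx; have : frontier (carrier X) x by rewrite fr; exists c.
by case.
Qed.

Lemma vertex_curve c v : curve_set (gamma c) (pos v) <-> v \in gamma c.
Proof.
split=> [[k kc hk]|vc].
  have [s [sX ss _]] := link_hull (link_next kc).
  by have := vertex_hull hX sX ss hk; rewrite !inE => /orP[] /eqP ->; rewrite ?mem_next.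
exists v => //; exists (fun i => (i == v)%:R); split=> //.
- by move=> i; rewrite !inE negb_or => /andP[/negbTE ->].
- by rewrite (bigD1 v) //= eqxx big1 ?addr0 // => i /negbTE ->.
- by rewrite (bigD1 v) //= eqxx scale1r big1 ?addr0 // => i /negbTE ->; rewrite scale0r.
Qed.

Lemma gamma_disjoint c c' v : v \in gamma c -> v \in gamma c' -> c = c'.
Proof.
move=> /vertex_curve vc /vertex_curve vc'; apply/eqP/negPn/negP => cc.
by case: hgamma => _ /(_ _ _ cc) h _ _ _; have : (set0 : set 'rV[R]_2) (pos v) by rewrite -h.
Qed.

Lemma interior_vertex v : interior (carrier X) (pos v) <-> forall c, v \notin gamma c.
Proof.
split=> [iv c|nv].
  by apply/negP => /vertex_curve /curve_frontier.
apply: contrapT => niv; case: hgamma => _ _ fr _ _.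
have : frontier (carrier X) (pos v).
  split=> //; apply: subset_closure; case: hX => _ /(_ v) [t tX vt] _ _ _; exists t => //.
  by apply/(hull_tri hX _ tX) => j; rewrite bary_vertex // ler0n.
rewrite fr => -[c _] /vertex_curve; exact/negP.
Qed.

End Faces.

(** * The capped complex and its face count *)

Section Euler.
Variables (R : realType) (X : triangulation R) (g : nat).
Variable gamma : 'I_g.+1 -> seq 'I_(nvert X).
Hypothesis hX : triangulated_domain X.
Hypothesis hgamma : bounded_by gamma.
Implicit Types (s t S : {set 'I_(nvert X)}) (i j k l v w : 'I_(nvert X)).
Implicit Types (a b : edge X) (c : 'I_g.+1).
Local Notation pos := (@pos R X).
Local Notation adjacent := (@Defs.adjacent R X).
Local Notation face := (@face R X g).
Local Notation on_face := (on_face gamma).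
Local Notation link := (link gamma).

(** The midpoint decides: with two triangles it is interior, hence on no curve; with one it is on
    the frontier, hence on a curve, and disjointness leaves only one. *)
Lemma edge_sides a :
  (exists s t, [/\ s \in tri X, t \in tri X, s != t,
     forall u, u \in tri X -> (ends a \subset u)%SET = (u == s) || (u == t)
     & forall c, ~~ link c (ends a)]) \/
  (exists t c, [/\ t \in tri X, forall u, u \in tri X -> (ends a \subset u)%SET = (u == t)
     & forall c', link c' (ends a) = (c' == c)]).
Proof.
have [t tX at_] := ends_tri a.
have mem (u : {set _}) : (ends a \subset u)%SET = ((val a).1 \in u) && ((val a).2 \in u).
  by rewrite finset.subUset !finset.sub1set.
have /andP[i1 i2] : ((val a).1 \in t) && ((val a).2 \in t) by rewrite -mem.
have an := ends_neq a; set m := mid (val a).1 (val a).2.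
have em : hull (ends a) m := hull_mid an.
case: (boolP [exists s in tri X, (s != t) && (ends a \subset s)%SET]).
  case/existsP => s /and3P[sX st as_]; left; exists s, t.
  have /andP[j1 j2] : ((val a).1 \in s) && ((val a).2 \in s) by rewrite -mem.
  split=> // [u uX|c].
    apply/idP/orP => [|[] /eqP -> //]; rewrite mem => /andP[k1 k2].
    have /or3P[|/eqP ut|/eqP us] := edge_at_most_two hX sX tX uX an j1 j2 i1 i2 k1 k2.
    - by rewrite (negbTE st).
    - by right; rewrite ut.
    - by left; rewrite us.
  apply/negP => /(link_hull hgamma) [s' [_ _ /(_ _ em) /(curve_frontier hgamma)]]; apply.
  exact: (mid_interior hX sX tX st).
rewrite negb_exists => /forallP uniq_t; right.
have only u : u \in tri X -> (ends a \subset u)%SET = (u == t).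
  move=> uX; apply/idP/eqP => [au|-> //]; apply/eqP; have := uniq_t u.
  by rewrite uX au andbT /= negbK.
have ht : hull t m by apply: hull_subset em.
have nint : ~ interior (carrier X) m.
  by apply: (mid_not_interior hX tX) => // s sX s1 s2; apply/eqP; rewrite -only // mem s1.
have : frontier (carrier X) m by split=> //; apply: subset_closure; exists t.
case: (hgamma) => _ _ -> _ _ [c _ [k kc hk]].
have lk := link_next kc; have [s [sX ss _]] := link_hull hgamma lk.
(* The midpoint has nonzero coordinates at both ends of [a], so the link containing it has the same
   ends. *)
have mE i : i \in ends a -> i \in [set k; next (gamma c) k]%SET.
  move=> ia; apply: (bary_support hX sX tX ss ht hk); rewrite bary_mid //.
  move: ia; rewrite !inE => /orP[] /eqP ->; rewrite eqxx.
    by rewrite (negbTE an) addr0 mulr1 invr_eq0.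
  by rewrite [_ == (val a).1]eq_sym (negbTE an) add0r mulr1 invr_eq0.
have aE : ends a = [set k; next (gamma c) k]%SET.
  have /andP[kn _] := gamma_adjacent hgamma kc.
  apply/eqP; rewrite finset.eqEcard !cards2 an kn leqnn andbT; exact/fintype.subsetP.
exists t, c; split=> // c'; apply/idP/eqP => [lc'|->]; last by rewrite aE.
have kn : k != next (gamma c) k by have /andP[] := gamma_adjacent hgamma kc.
move: lc'; rewrite aE => /(link_mem hgamma) /(_ kn) [kc' _].
exact: (gamma_disjoint hX hgamma) kc' kc.
Qed.

Lemma edge_faces a : exists f1 f2, f1 != f2 /\ forall f, on_face f a = (f \in [set f1; f2]%SET).
Proof.
case: (edge_sides a) => [[s [t [sX tX st uE nl]]]|[t [c [tX uE lE]]]].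
  exists (inl (exist _ s sX)), (inl (exist _ t tX)); split=> [//|[[u uX]|c]]; rewrite !inE.
    by rewrite /= uE.
  by rewrite /= (negbTE (nl c)).
exists (inl (exist _ t tX)), (inr c); split=> [//|[[u uX]|c']]; rewrite !inE.
  by rewrite /= uE // orbF.
by rewrite /= lE.
Qed.

Lemma sum_edge_faces a (u : face -> bool) f1 f2 : f1 != f2 -> on_face f1 a -> on_face f2 a ->
  \sum_f u f * on_face f a = u f1 + u f2.
Proof.
move=> f12 o1 o2; have [h1 [h2 [_ hE]]] := edge_faces a.
have E f : on_face f a = (f \in [set f1; f2]%SET).
  rewrite hE; have := o1; have := o2; rewrite !hE !inE => /orP[] /eqP e2 /orP[] /eqP e1;
  by move: f12; rewrite e1 e2 ?eqxx // orbC.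
rewrite (sum2 f12) => [|f nf]; first by rewrite o1 o2 !mulr1.
by rewrite E (negbTE nf) mulr0.
Qed.

Lemma face_closed f v : \sum_a on_face f a * (v \in ends a) = 0.
Proof.
rewrite (sum_bool_odd predT (fun a => on_face f a && (v \in ends a))).
by rewrite -big_mkcond sum1_card (corner_degree hX hgamma) oddM.
Qed.

(* A boundary vertex lies on exactly two boundary edges. *)
Lemma link_constant (o : edge X -> bool) c :
  (forall v, \sum_a o a * (v \in ends a) = 0) ->
  (forall a, o a -> exists c, link c (ends a)) ->
  exists r, forall a, link c (ends a) -> o a = r.
Proof.
move=> even olink.
(* Transfers [o] from the links to their first vertices, where [cycle_constant] applies. *)
pose P k := [exists a, (ends a == [set k; next (gamma c) k]%SET) && o a].
have PE k a : ends a = [set k; next (gamma c) k]%SET -> P k = o a.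
  move=> aE; apply/existsP/idP => [[b /andP[/eqP bE ob]]|oa].
    by have <- : b = a by apply: ends_inj; rewrite aE.
  by exists a; rewrite aE eqxx.
have Pn k : k \in gamma c -> P (next (gamma c) k) = P k.
  move=> kc; set n := next (gamma c) k; have nc : n \in gamma c by rewrite mem_next.
  have [a2 a2E] := edge_exists (gamma_adjacent hgamma kc).
  have [a1 a1E] := edge_exists (gamma_adjacent hgamma nc).
  rewrite (PE _ _ a1E) (PE _ _ a2E); apply/eqP; rewrite -addr_eq0.
  have pn : prev (gamma c) n = k by rewrite prev_next // (gamma_uniq hgamma).
  have a12 : a1 != a2.
    apply/eqP => e; rewrite e a2E -/n finset.setUC in a1E.
    have := next_neq_prev (gamma_uniq hgamma c) (gamma_size hgamma c) nc.
    by rewrite pn (set2_inj a1E) eqxx.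
  have na1 : n \in ends a1 by rewrite a1E !inE eqxx.
  have na2 : n \in ends a2 by rewrite a2E !inE eqxx orbT.
  have := even n; rewrite (sum2 a12) => [|a].
    by rewrite na1 na2 !mulr1 => /eqP.
  (* Any edge of [o] at [n] is a link, necessarily of the same curve, so it joins [n] to its
     successor or predecessor. *)
  apply: contraNeq; case oa : (o a) => //; case: (boolP (n \in ends a)) => // na _.
  have [w nw aE] := ends_adjacent na; have [c' lc'] := olink a oa.
  have nw' : n != w by case/andP: nw.
  move: lc'; rewrite aE => /(link_mem hgamma) /(_ nw') [nc' wE].
  have c'E := gamma_disjoint hX hgamma nc' nc; rewrite c'E pn in wE.
  rewrite !inE; case: wE => wE; apply/orP; [left|right]; apply/eqP/ends_inj.
    by rewrite aE a1E wE.
  by rewrite aE a2E wE finset.setUC.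
have [k0 k0c] := gamma_inhabited hgamma c.
exists (P k0) => a /hasP[k kc /eqP aE]; rewrite -(PE _ _ aE).
exact: (cycle_constant (gamma_uniq hgamma c)).
Qed.

(* The sum [o] of [z] and of the boundary of the odd triangles is an even set of
   boundary edges; capping the curves that it contains accounts for it. *)
Lemma even_boundary (z : edge X -> bool) : (forall v, \sum_a z a * (v \in ends a) = 0) ->
  exists u : face -> bool, forall a, z a = \sum_f u f * on_face f a.
Proof.
move=> even; have [p pE] := even_potential hX even.
pose w (f : face) := if f is inl t then p (val t) else false.
pose o a := z a + \sum_f w f * on_face f a.
have oeven v : \sum_a o a * (v \in ends a) = 0.
  under eq_bigr do rewrite mulrDl mulr_suml.
  rewrite big_split /= even add0r exchange_big /= big1 // => f _.
  by under eq_bigr do rewrite -mulrA; rewrite -mulr_sumr face_closed mulr0.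
have olink a : o a -> exists c, link c (ends a).
  case: (edge_sides a) => [[s [t [sX tX st uE _]]]|[t [c [_ _ lE]]] _]; last first.
    by exists c; rewrite lE.
  have as_ : (ends a \subset s)%SET by rewrite uE // eqxx.
  have at_ : (ends a \subset t)%SET by rewrite uE // eqxx orbT.
  rewrite /o (@sum_edge_faces a _ (inl (exist _ s sX)) (inl (exist _ t tX))) //=.
  by rewrite (pE s t a) // -[_ + _]/(_ (+) _) addbb.
have [r rE] := choice (fun c => @link_constant o c oeven olink).
exists (fun f => if f is inr c then r c else w f) => a.
case: (edge_sides a) => [[s [t [sX tX st uE _]]]|[t [c [tX uE lE]]]].
  have as_ : (ends a \subset s)%SET by rewrite uE // eqxx.
  have at_ : (ends a \subset t)%SET by rewrite uE // eqxx orbT.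
  rewrite (@sum_edge_faces a _ (inl (exist _ s sX)) (inl (exist _ t tX))) //=.
  exact: pE.
have at_ : (ends a \subset t)%SET by rewrite uE.
have lc : link c (ends a) by rewrite lE.
rewrite (@sum_edge_faces a _ (inl (exist _ t tX)) (inr c)) //= -(rE c a lc) /o.
rewrite (@sum_edge_faces a _ (inl (exist _ t tX)) (inr c)) //=.
by rewrite addr0 [z a + _]addrC addrA -[p t + p t]/(p t (+) p t) addbb add0r.
Qed.

Lemma vertex_connected (u : 'I_(nvert X) -> bool) :
  (forall a, \sum_v u v * (v \in ends a) = 0) -> forall v w, u v = u w.
Proof.
move=> u0; have uadj i j : adjacent i j -> u i = u j.
  move=> ij; have [a aE] := edge_exists ij; have /andP[nij _] := ij.
  have := u0 a; rewrite (sum2 nij) => [|l]; last by rewrite -aE => /negbTE ->; rewrite mulr0.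
  by rewrite aE !inE !eqxx orbT !mulr1 => /eqP; rewrite addr_eq0 => /eqP.
move=> v w; have [_ cov _ _ _] := hX; have [t tX vt] := cov v; have [s sX ws] := cov w.
have utri r i j : r \in tri X -> i \in r -> j \in r -> u i = u j.
  move=> rX ir jr; case: (eqVneq i j) => [-> //|ij]; exact/uadj/(tri_adjacent rX).
have Pt : [forall i in t, u i == u v].
  by apply/forall_inP => i it; apply/eqP; exact: (utri t).
suff /forall_inP hs : [forall i in s, u i == u v] by rewrite (eqP (hs w ws)).
apply: (dual_connected hX (P := fun r => [forall i in r, u i == u v]) tX Pt _ sX).
move=> r q rX qX /forall_inP Pr rq; have /card_gt0P[k] : (0 < #|(r :&: q)%SET|)%N by rewrite rq.
rewrite inE => /andP[kr kq]; apply/forall_inP => i iq.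
by rewrite (utri q i k) // Pr.
Qed.

Lemma face_connected (u : face -> bool) :
  (forall a, \sum_f u f * on_face f a = 0) -> forall f h, u f = u h.
Proof.
move=> u0; have ushare a f h : on_face f a -> on_face h a -> u f = u h.
  move=> fa ha; case: (eqVneq f h) => [-> //|fh].
  by have := u0 a; rewrite (sum_edge_faces _ fh) // => /eqP; rewrite addr_eq0 => /eqP.
have utri (t s : {t | t \in tri X}) : u (inl t) = u (inl s).
  pose P q := [forall r : {t | t \in tri X}, (val r == q) ==> (u (inl r) == u (inl s))].
  suff /forallP /(_ t) : P (val t) by rewrite eqxx => /eqP.
  apply: (dual_connected hX (valP s)) => [||]; last exact: valP.
    by apply/forallP => r; apply/implyP => /eqP/val_inj ->.
  move=> q q' qX q'X /forallP Pq qq'; apply/forallP => r; apply/implyP => /eqP rE.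
  have /cards2P [i [j [ij qE]]] : #|(q :&: q')%SET| == 2%N by rewrite qq'.
  have : i \in (q :&: q')%SET by rewrite qE !inE eqxx.
  have : j \in (q :&: q')%SET by rewrite qE !inE eqxx orbT.
  rewrite !inE => /andP[jq jq'] /andP[iq iq'].
  have [a aE] := edge_exists (tri_adjacent qX iq jq ij).
  have -> : u (inl r) = u (inl (exist _ q qX)).
    by apply: (ushare a); rewrite /= aE -qE ?rE ?finset.subsetIl ?finset.subsetIr.
  by have := Pq (exist _ q qX); rewrite eqxx.
have ucurve c (s : {t | t \in tri X}) : u (inr c) = u (inl s).
  have [k kc] := gamma_inhabited hgamma c.
  have [a aE] := edge_exists (gamma_adjacent hgamma kc).
  have [t tX at_] := ends_tri a.
  rewrite -(utri (exist _ t tX)); apply: (ushare a) => //=; rewrite aE; exact: link_next.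
have [[s sX]] : exists s : {t | t \in tri X}, True.
  have [_ cov _ _ _] := hX; have [k _] := gamma_inhabited hgamma ord0.
  by have [t tX _] := cov k; exists (exist _ t tX).
move=> _; suff h f : u f = u (inl (exist _ s sX)) by move=> f h'; rewrite !h.
by case: f.
Qed.

(** Double counting of incident pairs: each corner is on two edges of the face, each edge has two
    ends. *)
Lemma face_edges f : #|[pred a | on_face f a]| = #|corners gamma f|.
Proof.
apply/eqP; rewrite -(eqn_pmul2l (isT : 0 < 2)%N); apply/eqP.
transitivity (\sum_v #|[pred a | on_face f a && (v \in ends a)]|)%N; last first.
  under eq_bigr do rewrite (corner_degree hX hgamma).
  rewrite -big_distrr /=; congr (_ * _)%N.
  by rewrite -big_mkcond sum1_card.
under eq_bigr do rewrite -sum1_card big_mkcond.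
rewrite exchange_big /= mulnC -sum_nat_const big_mkcond /=; apply: eq_bigr => a _.
symmetry; rewrite [in RHS]inE; transitivity (\sum_v (on_face f a && (v \in ends a)))%N.
  by apply: eq_bigr => v _; rewrite inE; case: (_ && _).
case: (on_face f a) => /=; last by rewrite big1.
by rewrite -big_mkcond sum1_card cards2 ends_neq.
Qed.

Lemma maxwell_count : (#|{: edge X}| + 3 = 2 * nvert X + 3 * g + interior_vertices X)%N.
Proof.
have [n0 _] := gamma_inhabited hgamma ord0.
have V0 : (0 < #|{: 'I_(nvert X)}|)%N by apply/card_gt0P; exists n0.
have F0 : (0 < #|{: face}|)%N by apply/card_gt0P; exists (inr ord0).
have card_face : #|{: face}| = (#|tri X| + g.+1)%N.
  by rewrite card_sum card_sig card_ord.
have eul : (nvert X + (#|tri X| + g.+1) = #|{: edge X}|.+2)%N.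
  rewrite -card_face -[X in (X + _)%N]card_ord.
  apply: (@euler_formula _ _ _ (fun v a => v \in ends a) on_face V0 F0).
  - move=> a; rewrite (sum2 (ends_neq a)) => [|l /negbTE -> //].
    by rewrite !inE !eqxx orbT.
  - move=> a; have [f1 [f2 [f12 fE]]] := edge_faces a.
    transitivity (\sum_f 1 * on_face f a); first by apply: eq_bigr => f _; rewrite mul1r.
    by rewrite (@sum_edge_faces a (fun=> 1) _ _ f12) ?fE ?inE ?eqxx ?orbT.
  - exact: vertex_connected.
  - exact: face_connected.
  - exact: face_closed.
  - exact: even_boundary.
have sides : (2 * #|{: edge X}| = 3 * #|tri X| + \sum_c size (gamma c))%N.
  transitivity (\sum_f #|[pred a | on_face f a]|)%N.
    under eq_bigr do rewrite -sum1_card big_mkcond.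
    rewrite exchange_big /= mulnC -sum_nat_const; apply: eq_bigr => a _.
    have [f1 [f2 [f12 fE]]] := edge_faces a.
    rewrite -big_mkcond sum1_card -(eq_card (A := [set f1; f2]%SET)) ?cards2 ?f12 //.
    by move=> f; rewrite [RHS]inE fE.
  under eq_bigr do rewrite face_edges.
  rewrite big_sumType /=; congr (_ + _)%N; last first.
    by apply: eq_bigr => c _; rewrite cardsE; apply/card_uniqP/(gamma_uniq hgamma).
  under eq_bigr => t _ do rewrite (tri_card hX (valP t)).
  by rewrite sum_nat_const card_sig mulnC.
have verts : (nvert X = interior_vertices X + \sum_c size (gamma c))%N.
  rewrite -[LHS]card_ord -(cardC [pred i | pos i \in (interior (carrier X) : set _)]).
  congr (_ + _)%N.
  transitivity (\sum_c \sum_v (v \in gamma c))%N; last first.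
    apply: eq_bigr => c _; rewrite -big_mkcond sum1_card.
    exact/card_uniqP/(gamma_uniq hgamma).
  rewrite exchange_big /= -sum1_card big_mkcond /=; apply: eq_bigr => v _.
  rewrite !inE; case: ifP => [|/negbFE].
    move/negP => iv; have [c vc] : exists c, v \in gamma c.
      apply: contrapT => nv; apply: iv; rewrite in_setE; apply/(interior_vertex hX hgamma) => c.
      by apply/negP => vc; apply: nv; exists c.
    rewrite (bigD1 c) //= vc big1 // => c' cc'.
    case: (boolP (v \in gamma c')) => // vc'.
    by rewrite (gamma_disjoint hX hgamma vc' vc) eqxx in cc'.
  rewrite in_setE => /(interior_vertex hX hgamma) nv.
  by rewrite big1 // => c _; rewrite (negbTE (nv c)).
(* Three times [eul] eliminates the triangles by [sides]; then [verts] eliminates the total length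
   of the curves. *)
lia.
Qed.
End Euler.

(** * Rigidity *)

Lemma dotE (R : realType) (u v : 'rV[R]_2) : dot u v = u 0 0 * v 0 0 + u 0 1 * v 0 1.
Proof.
by rewrite /dot big_ord_recl big_ord1; congr (_ + u 0 _ * v 0 _); exact/val_inj.
Qed.

(** Translation by [r.1] plus infinitesimal rotation of rate [r.2]. Centring at the vertex [i] makes
    [r.1] the velocity of [i]. *)
Definition rigid_motion (R : realType) (X : triangulation R) (i : 'I_(nvert X))
    (r : 'rV[R]_2 * R^o) : {ffun 'I_(nvert X) -> 'rV[R]_2} :=
  [ffun k => r.1 + \row_m (if m == 0 then - r.2 * (pos k - pos i) 0 1
                          else r.2 * (pos k - pos i) 0 0)].

Lemma rigid_motion_is_linear (R : realType) (X : triangulation R) (i : 'I_(nvert X)) :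
  linear (rigid_motion i).
Proof.
move=> a u v; apply/ffunP => k; rewrite !ffunE; apply: rowP2; rewrite !mxE /= /GRing.scale /=; ring.
Qed.

HB.instance Definition _ (R : realType) (X : triangulation R) (i : 'I_(nvert X)) :=
  GRing.isLinear.Build R ('rV[R]_2 * R^o)%type {ffun 'I_(nvert X) -> 'rV[R]_2}
    _ (rigid_motion i) (@rigid_motion_is_linear R X i).

Section Rigidity.
Variables (R : realType) (X : triangulation R).
Hypothesis hX : triangulated_domain X.
Implicit Types (s t : {set 'I_(nvert X)}) (i j k l : 'I_(nvert X)).
Implicit Types (U : {ffun 'I_(nvert X) -> 'rV[R]_2}).
Local Notation pos := (@pos R X).
Local Notation adjacent := (@Defs.adjacent R X).

Lemma elongation0P U : elongation U = 0 <->
  forall i j, adjacent i j -> dot (pos i - pos j) (U i - U j) = 0.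
Proof.
split=> [/ffunP e i j ij|h]; last first.
  by apply/ffunP => a; rewrite !ffunE; apply: h; have /andP[] := valP a.
have [a aE] := edge_exists ij; have := e a; rewrite !ffunE.
have : (val a).1 \in [set i; j]%SET by rewrite -aE !inE eqxx.
have : (val a).2 \in [set i; j]%SET by rewrite -aE !inE eqxx orbT.
have := ends_neq a; rewrite !inE => an /orP[] /eqP a2 /orP[] /eqP a1;
  move: an; rewrite a1 a2 ?eqxx // => _;
by rewrite !dotE !mxE => h; rewrite -[RHS]h; ring.
Qed.

(** The velocity of the third vertex is orthogonal to two independent sides. *)
Lemma triangle_rigid t i j U : elongation U = 0 ->
  t \in tri X -> i != j -> i \in t -> j \in t -> U i = 0 -> U j = 0 -> forall k, k \in t -> U k = 0.
Proof.
move=> /elongation0P h tX ij it jt Ui Uj l lt.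
have [k [tE ik jk]] := card3_third (tri_card hX tX) ij it jt.
have D0 := free_orient ((tri_triangle hX tX).2 _ _ _ tE).
move: lt; rewrite {1}tE !inE => /orP[/orP[]|] /eqP -> //.
have kt : k \in t by rewrite tE !inE eqxx !orbT.
have := h _ _ (tri_adjacent tX it kt ik); have := h _ _ (tri_adjacent tX jt kt jk).
rewrite Ui Uj !dotE !mxE => hj hi; apply: rowP2; rewrite mxE; apply: (mulIf D0);
  rewrite mul0r /orient /shear /= !mul0r !addr0.
  have := congr1 (fun r => r * (pos j 0 1 - pos k 0 1)) hi.
  by have := congr1 (fun r => r * (pos i 0 1 - pos k 0 1)) hj; lra.
have := congr1 (fun r => r * (pos j 0 0 - pos k 0 0)) hi.
by have := congr1 (fun r => r * (pos i 0 0 - pos k 0 0)) hj; lra.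
Qed.

Lemma infinitesimally_rigid t i j U : elongation U = 0 ->
  t \in tri X -> i != j -> i \in t -> j \in t -> U i = 0 -> U j = 0 -> U = 0.
Proof.
move=> h tX ij it jt Ui Uj; apply/ffunP => k; rewrite ffunE.
have [_ /(_ k) [s sX ks] _ _ _] := hX.
suff /forall_inP /(_ k ks) /eqP : [forall l in s, U l == 0] by [].
apply: (dual_connected hX (P := fun r => [forall l in r, U l == 0]) tX _ _ sX).
  by apply/forall_inP => l lt; rewrite (triangle_rigid h tX ij it jt).
move=> r q rX qX /forall_inP Pr rq.
have /cards2P [m [n [mn qE]]] : #|(r :&: q)%SET| == 2%N by rewrite rq.
have : m \in (r :&: q)%SET by rewrite qE !inE eqxx.
have : n \in (r :&: q)%SET by rewrite qE !inE eqxx orbT.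
rewrite !inE => /andP[nr nq] /andP[mr mq].
by apply/forall_inP => l lq; rewrite (triangle_rigid h qX mn mq nq) //; apply/eqP/Pr.
Qed.

Lemma dim_motions : (0 < nvert X)%N -> \dim (lker (linfun (@elongation R X))) = 3%N.
Proof.
move=> n0; have [_ /(_ (Ordinal n0)) [t tX it] _ _ _] := hX; set i := Ordinal n0 in it.
have [j jt ij] := card3_other (tri_card hX tX) it.
set d := pos j - pos i.
have n2 : d 0 0 ^+ 2 + d 0 1 ^+ 2 != 0.
  have [inj _ _ _ _] := hX; apply: contraNneq ij => /eqP.
  rewrite paddr_eq0 ?sqr_ge0 // !sqrf_eq0 !mxE !subr_eq0 => /andP[/eqP e0 /eqP e1].
  by apply/eqP/esym/inj/rowP2.
have rigid0 r : elongation (rigid_motion i r) = 0.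
  by apply/elongation0P => k l _; rewrite dotE !ffunE !mxE /=; ring.
have kerE : lker (linfun (@elongation R X)) = limg (linfun (rigid_motion i)).
  apply/vspaceP => U; rewrite memv_ker lfunE /=; apply/eqP/memv_imgP => [h|[r _ ->]]; last first.
    by rewrite lfunE /= rigid0.
  set w := U j - U i.
  have dw : d 0 0 * w 0 0 + d 0 1 * w 0 1 = 0.
    rewrite -[RHS]((elongation0P U).1 h _ _ (tri_adjacent tX it jt ij)) dotE !mxE; ring.
  have [q w0 w1] : exists2 q, w 0 0 = - q * d 0 1 & w 0 1 = q * d 0 0.
    (* By [dw], [w] is orthogonal to [d], hence a multiple of [d] turned by a right angle;
       projecting on that vector gives the rate. *)
    exists ((d 0 0 * w 0 1 - d 0 1 * w 0 0) / (d 0 0 ^+ 2 + d 0 1 ^+ 2)); apply: (mulIf n2).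
      rewrite mulNr mulNr mulrAC divfK //.
      by have := congr1 (fun r => r * d 0 0) dw; lra.
    rewrite mulrAC divfK //.
    by have := congr1 (fun r => r * d 0 1) dw; lra.
  (* This rigid motion agrees with [U] at both [i] and [j], so the difference falls under
     [infinitesimally_rigid]. *)
  exists (U i, q); rewrite ?memvf // lfunE /=; apply/eqP; rewrite -subr_eq0; apply/eqP.
  apply: (infinitesimally_rigid _ tX ij it jt).
  - by rewrite linearB /= h rigid0 subr0.
  - by rewrite !ffunE; apply: rowP2; rewrite !mxE /=; ring.
  by move: w0 w1; rewrite !ffunE /w /d !mxE => w0 w1; apply: rowP2; rewrite !mxE /=; lra.
have inj : lker (linfun (rigid_motion i)) = 0%VS.
  apply/eqP; rewrite -subv0; apply/subvP => r; rewrite memv_ker lfunE memv0 => /eqP/ffunP e.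
  have r1 : r.1 = 0.
    have := e i; rewrite !ffunE subrr => /rowP ei.
    by apply: rowP2; rewrite mxE; [have := ei 0|have := ei 1]; rewrite !mxE /= mulr0 addr0.
  have := e j; rewrite !ffunE r1 add0r -/d => /rowP ej.
  have h0 := ej 0; have h1 := ej 1; rewrite !mxE /= in h0 h1.
  suff r2 : r.2 = 0 by case: (r) r1 r2 => r1' r2' /= -> ->.
  apply: (mulIf n2); rewrite mul0r.
  have := congr1 (fun x => x * d 0 1) h0; have := congr1 (fun x => x * d 0 0) h1.
  by rewrite /d !mxE; lra.
have := limg_ker_dim (linfun (rigid_motion i)) fullv.
by rewrite inj capv0 dimv0 add0n kerE => ->; rewrite dimvf.
Qed.

Lemma compat_number_maxwell : (0 < nvert X)%N ->
  (compat_number X + 2 * nvert X = #|{: edge X}| + 3)%N.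
Proof.
move=> n0; have := limg_ker_dim (linfun (@elongation R X)) fullv.
rewrite capfv dim_motions // /compat_number !dimvf.
have -> : dim {ffun edge X -> R^o} = #|{: edge X}| by rewrite /dim /= muln1.
have -> : dim {ffun 'I_(nvert X) -> 'rV[R]_2} = (2 * nvert X)%N.
  by rewrite /dim /= card_ord mulnC.
(* The subtraction in [compat_number] is truncated; it is exact because the image is a subspace. *)
have := dimvS (subvf (limg (linfun (@elongation R X)))).
rewrite dimvf.
have -> : dim {ffun edge X -> R^o} = #|{: edge X}| by rewrite /dim /= muln1.
lia.
Qed.
End Rigidity.

Theorem theorem13 (R : realType) (X : triangulation R) (g : nat)
    (gamma : 'I_g.+1 -> seq 'I_(nvert X))
    (hX : triangulated_domain X) (hgamma : bounded_by gamma) :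
  generic X /\ maxwell X = 3 * g%:Z + (interior_vertices X)%:Z.
Proof.
have n0 : (0 < nvert X)%N.
  have [k _] := gamma_inhabited hgamma ord0; exact: leq_ltn_trans (leq0n k) (ltn_ord k).
have := maxwell_count hX hgamma; have := compat_number_maxwell hX n0.
by rewrite /generic /maxwell; split; lia.
Qed.
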